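(* There exists a constant $\varepsilon>0$ with the following property. Let $n$ be a large positive integer and let $p<\varepsilon\left(\frac{\log n}{n}\right)^{1/2}$. If $X,Y\sim\mathcal{G}(n,p)$ are chosen independently, then with high probability (i.e. with probability tending to $1$ as $n\to\infty$) the friends-and-strangers graph $\mathsf{FS}(X,Y)$ has an isolated vertex. The same statement holds if instead $X,Y\sim\mathcal{G}(K_{n,n},p)$ are chosen independently.
   Context: For simple graphs $X,Y$ with the same number of vertices, the friends-and-strangers graph $\mathsf{FS}(X,Y)$ has as vertices all bijections $\sigma:V(X)\to V(Y)$; two bijections $\sigma,\tau$ are adjacent if $\sigma=\tau\circ(a\ b)$ for some $a,b\in V(X)$ with $ab\in E(X)$ and $\sigma(a)\sigma(b)\in E(Y)$ (here $(a\ b)$ is the transposition of $a,b$). $\mathcal{G}(n,p)$ is the Erdős–Rényi random graph on $n$ vertices with each edge present independently with probability $p$. $\mathcal{G}(K_{n,n},p)$ is the random bipartite graph obtained from the complete bipartite graph $K_{n,n}$ (two fixed parts of size $n$) by keeping each edge independently with probability $p$. *)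

(* Defs.v *)
From HB Require Import structures.
From mathcomp Require Import all_boot all_order all_algebra all_fingroup.

Set Implicit Arguments.
Unset Strict Implicit.
Unset Printing Implicit Defensive.

Import Order.TTheory GRing.Theory Num.Theory.

Record sgraph (V : finType) := SGraph {
  edges : {set {set V}};
  _ : [forall e in edges, #|e| == 2]
}.

HB.instance Definition _ (V : finType) := [isSub for @edges V].
HB.instance Definition _ (V : finType) := [Finite of sgraph V by <:].

Definition adj (V : finType) (G : sgraph V) : rel V :=
  fun x y => [set x; y] \in edges G.

Definition isolated (V : finType) (G : sgraph V) (v : V) : bool :=
  [forall u, ~~ adj G v u].

Definition rel_edges (V : finType) (r : rel V) : {set {set V}} :=
  [set e | [exists x, exists y, [&& x != y, r x y & e == [set x; y]]]].

Lemma rel_edgesP (V : finType) (r : rel V) :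
  [forall e in rel_edges r, #|e| == 2].
Proof.
apply/forall_inP => e; rewrite inE => /existsP[x /existsP[y]].
by case/and3P => xy _ /eqP->; rewrite cards2 xy.
Qed.

Definition rel_graph (V : finType) (r : rel V) : sgraph V :=
  SGraph (rel_edgesP r).

Lemma adj_rel_graph (V : finType) (r : rel V) :
  symmetric r -> forall x y, adj (rel_graph r) x y = (x != y) && r x y.
Proof.
move=> sr x y; rewrite /adj /= inE; apply/existsP/andP; last first.
  by case=> xy rxy; exists x; apply/existsP; exists y; rewrite xy rxy eqxx.
case=> a /existsP[b /and3P[ab rab /eqP E]].
have xy : x != y.
  by apply: contraTneq ab => xy; move: (cards2 a b); rewrite -E xy cards2 eqxx;
    case: (a != b).
split=> //.
have := set21 x y; have := set22 x y; rewrite E !inE.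
move: xy => /[swap] /orP[]/eqP-> /[swap] /orP[]/eqP->; rewrite ?eqxx //.
by rewrite sr.
Qed.

Definition complete (V : finType) : sgraph V := rel_graph (fun _ _ : V => true).

Definition complete_bipartite (A B : finType) : sgraph (A + B)%type :=
  rel_graph (fun u v : (A + B)%type =>
    match u, v with inl _, inr _ | inr _, inl _ => true | _, _ => false end).

Section FriendsAndStrangers.
Variables (V : finType) (X Y : sgraph V).

(* In {perm V}, (s * t) x = t (s x): tperm a b * t is the composite of t after
   the transposition (a b). *)
Definition fs_rel : rel {perm V} := fun s t =>
  [exists a, exists b,
    [&& adj X a b, adj Y (s a) (s b) & s == (tperm a b * t)%g]].

Definition FS : sgraph {perm V} := rel_graph fs_rel.

Lemma adj_FS (s t : {perm V}) : adj FS s t = fs_rel s t.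
Proof.
rewrite adj_rel_graph => [|{}s {}t].
  apply/andb_idl => /existsP[a /existsP[b /and3P[Xab _ /eqP->]]].
  have ab : a != b.
    case: X Xab => E /= /forall_inP EP /EP /=; rewrite cards2.
    by case: (a != b).
  apply: contraNneq ab => /(canRL (mulgK _)); rewrite mulgV => E.
  by have := tpermL a b; rewrite E perm1 => ->.
apply/existsP/existsP => -[a /existsP[b /and3P[Xab Yab /eqP E]]];
  exists a; apply/existsP; exists b; rewrite Xab;
  move: Yab; rewrite E !permM tpermL tpermR /adj setUC => ->;
  by rewrite mulgA tperm2 mul1g eqxx.
Qed.

End FriendsAndStrangers.

Section RandomSubgraph.
Variables (R : numDomainType) (V : finType) (H : sgraph V) (p : R).
Local Open Scope ring_scope.

(* The law of the random spanning subgraph of H in which each edge of H is kept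
   independently with probability p. *)
Definition subgraph_law (G : sgraph V) : R :=
  if edges G \subset edges H
  then \prod_(e in edges H) (if e \in edges G then p else 1 - p)
  else 0.

(* Probability of the event A for a pair of independent random subgraphs, i.e.
   under the product of two copies of subgraph_law. *)
Definition pair_prob (A : sgraph V -> sgraph V -> bool) : R :=
  \sum_(X : sgraph V) \sum_(Y : sgraph V | A X Y)
    subgraph_law X * subgraph_law Y.

Lemma subgraph_law_ge0 G : 0 <= p <= 1 -> 0 <= subgraph_law G.
Proof.
case/andP=> p0 p1; rewrite /subgraph_law; case: ifP => // _.
by apply: prodr_ge0 => e _; case: ifP => // _; rewrite subr_ge0.
Qed.

Lemma subgraph_law_sum1 : \sum_G subgraph_law G = 1.
Proof.
rewrite -big_mkcond /=.
transitivity (\prod_e ((if e \in edges H then p else 0) +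
                      (if e \in edges H then 1 - p else 1))); last first.
  by rewrite big1 // => e _; case: ifP; rewrite ?add0r // addrC subrK.
rewrite bigA_distr /=.
rewrite [RHS](bigID (fun E : {set {set V}} => E \subset edges H)) /=.
rewrite [X in _ = _ + X]big1 ?addr0; last first.
  move=> E /subsetPn[e eE eH]; rewrite (bigD1 e) //= eE (negPf eH).
  by rewrite mul0r.
have sub2 (E : {set {set V}}) : E \subset edges H -> [forall e in E, #|e| == 2].
  move=> EH; apply/forall_inP => e /(subsetP EH).
  by case: (H) => F /= /forall_inP; apply.
rewrite [RHS](reindex_omap (@edges V) insub) /=; last first.
  by move=> E /sub2 EP; rewrite insubT.
apply: eq_big => [G|G GH].
  by rewrite valK eqxx andbT.
rewrite big_mkcond; apply: eq_bigr => e _.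
case: ifP => eH; case: ifP => eG //.
by rewrite (subsetP GH _ eG) in eH.
Qed.

End RandomSubgraph.

Definition FS_has_isolated (V : finType) (X Y : sgraph V) : bool :=
  [exists s, isolated (FS X Y) s].

(* Main.v *)
Require Import Defs.
From HB Require Import structures.
From mathcomp Require Import all_boot all_order all_algebra all_fingroup.
From mathcomp Require Import ring lra zify.

(* An isolated vertex of FS(X, Y) is a bijection that maps no edge of X to an
   edge of Y.  In the bipartite case such a bijection is the identity on the
   left part and, on the right part, a perfect matching of the compatibility
   graph: a ~ b iff N_X(a) and N_Y(b) are disjoint.  Compatible pairs have
   density n^(-O(eps^2)).  A set violating Hall's condition gives A', B' with
   |A'| + |B'| > n and no compatible pair in between.  If one of them is small
   then some vertex has an abnormally small degree; if both are large, then,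
   conditionally on Y, the rows N_X(a) are independent and, by the second moment
   method, each of them hits all the N_Y(b), b in B', with probability at most
   4^-8, which beats the 4^n choices of (A', B').

   For G(n, p) the bijection is built block by block.  When a block C of about
   n^(3/8) vertices is added to the set A already treated, the edges between C
   and A are independent of everything exposed before, so the matching argument
   applies to C.  The few vertices of C incident to an edge of X inside C are
   not allowed to be matched to the vertices of C incident to an edge of Y
   inside C, which rules out conflicts within the block. *)

Set Implicit Arguments.
Unset Strict Implicit.
Unset Printing Implicit Defensive.

Import Order.TTheory GRing.Theory Num.Theory.
Local Open Scope ring_scope.

(** * Independent bits *)

Section Bits.
Variables (R : realFieldType) (p : R).
Hypothesis p01 : 0 <= p <= 1.

Definition bit_law (b : bool) : R := if b then p else 1 - p.

Definition bits_law (I : finType) (w : {ffun I -> bool}) : R :=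
  \prod_i bit_law (w i).

(** Expectation under independent bits. Events enter as indicators [%:R], so a union bound is a
    pointwise inequality followed by linearity. *)
Definition Ex (I : finType) (h : {ffun I -> bool} -> R) : R :=
  \sum_w bits_law w * h w.

Lemma bits_law_ge0 (I : finType) (w : {ffun I -> bool}) : 0 <= bits_law w.
Proof.
apply: prodr_ge0 => i _; rewrite /bit_law.
by case: ifP; move: p01 => /andP[? ?]; rewrite ?subr_ge0.
Qed.

Section OneSpace.
Variable I : finType.
Implicit Types (h g : {ffun I -> bool} -> R) (w u : {ffun I -> bool}).
Implicit Types S : {set I}.

Lemma eq_Ex h g : h =1 g -> Ex h = Ex g.
Proof. by move=> hg; apply: eq_bigr => w _; rewrite hg. Qed.

Lemma le_Ex h g : (forall w, h w <= g w) -> Ex h <= Ex g.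
Proof.
by move=> hg; apply: ler_sum => w _; rewrite ler_wpM2l ?bits_law_ge0.
Qed.

Lemma Ex_ge0 h : (forall w, 0 <= h w) -> 0 <= Ex h.
Proof. by move=> h0; apply: sumr_ge0 => w _; rewrite mulr_ge0 ?bits_law_ge0.
  Qed.

Lemma ExD h g : Ex (fun w => h w + g w) = Ex h + Ex g.
Proof. by rewrite -big_split; apply: eq_bigr => w _; rewrite mulrDr. Qed.

Lemma ExZ c h : Ex (fun w => c * h w) = c * Ex h.
Proof. by rewrite /Ex big_distrr; apply: eq_bigr => w _; rewrite mulrCA. Qed.

Lemma Ex_sum (J : finType) (P : pred J) (F : J -> {ffun I -> bool} -> R) :
  Ex (fun w => \sum_(j | P j) F j w) = \sum_(j | P j) Ex (F j).
Proof.
rewrite exchange_big; apply: eq_bigr => w _; by rewrite big_distrr.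
Qed.

(** Independence: expanding the product of the one-bit sums gives one term for each [w]. *)
Lemma Ex_prod (g : I -> bool -> R) :
  Ex (fun w => \prod_i g i (w i)) =
  \prod_i (p * g i true + (1 - p) * g i false).
Proof.
transitivity (\prod_i \sum_b bit_law b * g i b).
  by rewrite bigA_distr_bigA; apply: eq_bigr => w _; rewrite -big_split.
by apply: eq_bigr => i _; rewrite big_bool.
Qed.

Lemma Ex_cst c : Ex (fun _ : {ffun I -> bool} => c) = c.
Proof.
rewrite -[RHS]mulr1; have <- : Ex (fun _ : {ffun I -> bool} => 1) = 1.
  have := Ex_prod (fun _ _ => 1); under eq_Ex do rewrite big1_eq.
  by move=> ->; rewrite big1 // => i _; ring.
by rewrite -ExZ; apply: eq_Ex => w; rewrite mulr1.
Qed.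

Lemma Ex_cylinder S u :
  Ex (fun w => [forall i in S, w i == u i]%:R) = \prod_(i in S) bit_law (u i).
Proof.
transitivity (Ex (fun w => \prod_i (if i \in S then (w i == u i)%:R else 1))).
  apply: eq_Ex => w; case: (boolP [forall i in S, _]) => [/forall_inP eqS|].
    by rewrite big1 // => i _; case: ifP => // /eqS/eqP->; rewrite eqxx.
  case/forall_inPn => i iS /negPf ne.
  by rewrite (bigD1 i) //= iS ne mul0r.
rewrite (Ex_prod (fun i b => if i \in S then (b == u i)%:R else 1)).
rewrite [RHS]big_mkcond; apply: eq_bigr => i _; case: ifP => _; last by ring.
by rewrite /bit_law; case: (u i) => /=; ring.
Qed.

Lemma Ex_all_false S :
  Ex (fun w => [forall i in S, ~~ w i]%:R) = (1 - p) ^+ #|S|.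
Proof.
rewrite -prodr_const -[RHS](_ : \prod_(i in S) bit_law ([ffun=> false] i) = _).
  rewrite -Ex_cylinder; apply: eq_Ex => w; congr (_%:R).
  by congr nat_of_bool; apply: eq_forallb => i; rewrite ffunE eqbF_neg.
by apply: eq_bigr => i _; rewrite ffunE.
Qed.

Lemma Ex_all_true S :
  Ex (fun w => [forall i in S, w i]%:R) = p ^+ #|S|.
Proof.
rewrite -prodr_const -[RHS](_ : \prod_(i in S) bit_law ([ffun=> true] i) = _).
  rewrite -Ex_cylinder; apply: eq_Ex => w; congr (_%:R).
  by congr nat_of_bool; apply: eq_forallb => i; rewrite ffunE eqb_id.
by apply: eq_bigr => i _; rewrite ffunE.
Qed.

(** The generating function of a binomial variable, a source of exponential Markov bounds. *)
Lemma Ex_exp_card (c : R) S :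
  Ex (fun w => c ^+ #|[set i in S | w i]|) = (1 + p * (c - 1)) ^+ #|S|.
Proof.
transitivity (Ex (fun w => \prod_i (if (i \in S) && w i then c else 1))).
  by apply: eq_Ex => w; rewrite -big_mkcond -prodr_const; apply: eq_bigl => i;
    rewrite inE.
rewrite (Ex_prod (fun i b => if (i \in S) && b then c else 1)) -prodr_const.
rewrite [RHS]big_mkcond; apply: eq_bigr => i _.
by case: (i \in S) => /=; ring.
Qed.

Definition mix S w w' : {ffun I -> bool} :=
  [ffun i => if i \in S then w i else w' i].

(** Keeping the bits on [S] and redrawing the others preserves the law: the weight of an outcome [u]
    splits into a factor on [S] and one off [S], each a cylinder probability. This is how part of
    the edges is kept unexposed. *)
Lemma Ex_resample S h : Ex h = Ex (fun w => Ex (fun w' => h (mix S w w'))).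
Proof.
have cyl (T : {set I}) u : \sum_w bits_law w * [forall i in T, w i == u i]%:R =
    \prod_(i in T) bit_law (u i) by apply: Ex_cylinder.
transitivity (\sum_u h u * ((\sum_w bits_law w * [forall i in S, w i == u i]%:R)
   * (\sum_w' bits_law w' * [forall i in ~: S, w' i == u i]%:R))).
  apply: eq_bigr => u _; rewrite !cyl mulrC; congr (_ * _).
  rewrite /bits_law (bigID (mem S)) /=; congr (_ * _).
  by apply: eq_bigl => i; rewrite !inE.
rewrite /Ex; under eq_bigr => u _ do rewrite mulr_suml big_distrr /=.
rewrite exchange_big; apply: eq_bigr => w _.
under eq_bigr => u _ do rewrite big_distrr big_distrr /=.
rewrite exchange_big big_distrr; apply: eq_bigr => w' _ /=.
(* For given [w] and [w'], the two cylinder conditions single out [u = mix S w w']. *)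
rewrite (bigD1 (mix S w w')) //= big1 ?addr0 => [|u neu].
  have -> : [forall i in S, w i == mix S w w' i].
    by apply/forall_inP => i iS; rewrite ffunE iS.
  have -> : [forall i in ~: S, w' i == mix S w w' i].
    by apply/forall_inP => i; rewrite inE ffunE => /negPf ->.
  by rewrite !mulr1; ring.
case: (boolP [forall i in S, _]) => [/forall_inP eqS|];
  last by rewrite !(mulr0, mul0r).
case: (boolP [forall i in ~: S, _]) => [/forall_inP eqC|];
  last by rewrite !(mulr0, mul0r).
case/eqP: neu; apply/ffunP => i; rewrite ffunE; case: ifP => iS.
  by rewrite (eqP (eqS _ iS)).
by rewrite (eqP (eqC i _)) // inE iS.
Qed.

End OneSpace.

Lemma Ex_exchange (I J : finType) (h : {ffun I -> bool} -> {ffun J -> bool} ->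
  R) :
  Ex (fun x => Ex (fun y => h x y)) = Ex (fun y => Ex (fun x => h x y)).
Proof.
rewrite /Ex; under eq_bigr => x _ do rewrite big_distrr /=.
rewrite exchange_big; apply: eq_bigr => y _; rewrite big_distrr.
by apply: eq_bigr => x _ /=; rewrite mulrCA.
Qed.

(** Bits read along an injection are again independent: the fibre over [u] is a cylinder on the
    image of [phi]. *)
Lemma Ex_marginal (I J : finType) (phi : J -> I) (h : {ffun J -> bool} -> R) :
  injective phi -> Ex (fun w => h [ffun j => w (phi j)]) = Ex h.
Proof.
move=> phi_inj; pose f (w : {ffun I -> bool}) := [ffun j => w (phi j)].
rewrite /Ex (partition_big f xpredT) //=; apply: eq_bigr => u _.
transitivity (h u * \sum_(w : {ffun I -> bool} | f w == u) bits_law w).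
  rewrite big_distrr; apply: eq_bigr => w /eqP <- /=; exact: mulrC.
rewrite mulrC; congr (_ * _).
(* [v] transports [u] to the image of [phi]; its value [false] elsewhere is arbitrary. *)
pose v : {ffun I -> bool} := [ffun i => [exists j, (phi j == i) && u j]].
have vphi j : v (phi j) = u j.
  rewrite ffunE; apply/existsP/idP => [[j' /andP[/eqP/phi_inj-> //]]|uj].
  by exists j; rewrite eqxx.
transitivity (Ex (fun w => [forall i in [set phi j | j in J], w i == v i]%:R)).
  rewrite big_mkcond; apply: eq_bigr => w _.
  rewrite (_ : [forall i in _, _] = (f w == u)); first by case: (f w == u);
    rewrite ?mulr1 ?mulr0.
  apply/forall_inP/eqP => [eqv | fwu i /imsetP[j _ ->]].
    by apply/ffunP => j; rewrite ffunE -vphi; apply/eqP/eqv/imset_f.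
  by rewrite vphi -fwu ffunE.
rewrite Ex_cylinder big_imset; last by move=> ? ? _ _; apply: phi_inj.
by apply: eq_bigr => j _; rewrite vphi.
Qed.

Definition bitrow (B P : finType) (w : {ffun B * P -> bool}) (b : B) :
  {ffun P -> bool} := [ffun v => w (b, v)].

(** The rows of a random matrix are independent; the proof curries [B * P] and distributes the
    product. *)
Lemma Ex_rows (B P : finType) (g : B -> {ffun P -> bool} -> R) :
  Ex (fun w : {ffun B * P -> bool} => \prod_b g b (bitrow w b)) = \prod_b Ex (g
    b).
Proof.
rewrite bigA_distr_bigA.
pose unc (f : {ffun B -> {ffun P -> bool}}) : {ffun B * P -> bool} :=
  [ffun bv => f bv.1 bv.2].
have rowu f b : bitrow (unc f) b = f b by apply/ffunP => v; rewrite !ffunE.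
rewrite /Ex (reindex unc) /=; last first.
  exists (fun w => [ffun b => bitrow w b]) => [f _|w _]; apply/ffunP.
    by move=> b; rewrite ffunE rowu.
  by case=> b v; rewrite !ffunE.
apply: eq_bigr => f _; rewrite big_split; congr (_ * _).
  rewrite /bits_law pair_bigA; apply: eq_bigr => -[b v] _.
  by rewrite ffunE.
by apply: eq_bigr => b _; rewrite rowu.
Qed.

Lemma Ex_row (B P : finType) (b : B) (g : {ffun P -> bool} -> R) :
  Ex (fun w : {ffun B * P -> bool} => g (bitrow w b)) = Ex g.
Proof. by apply: (@Ex_marginal _ P (pair b) g) => v v' []. Qed.

End Bits.

Lemma natr_exists (R : numDomainType) (J : finType) (P : pred J) :
  [exists j, P j]%:R <= \sum_j (P j)%:R :> R.
Proof.
case: (boolP [exists j, _]) => [/existsP[j Pj]|_]; last exact: sumr_ge0.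
by rewrite (bigD1 j) //= Pj lerDl sumr_ge0.
Qed.

(** * Hall's theorem *)

Section Hall.
Variables (T U : finType) (u0 : U).
Implicit Types (r : T -> U -> bool) (A S : {set T}).

Definition nbhd r S : {set U} := [set u | [exists t in S, r t u]].

Lemma nbhdP r S u : reflect (exists2 t, t \in S & r t u) (u \in nbhd r S).
Proof. by rewrite inE; exact: exists_inP. Qed.

(** Induction on the size of [A], according to whether some nonempty proper subset is tight, that
    is, has no more neighbours than elements. The point [u0] supplies a value when [A] is empty. *)
Theorem Hall_marriage r A :
    (forall S, S \subset A -> #|S| <= #|nbhd r S|)%N ->
  exists2 f : T -> U, {in A &, injective f} & {in A, forall t, r t (f t)}.
Proof.
elim: {A}_.+1 {-2}A (ltnSn #|A|) r => // n IHn A; rewrite ltnS => leAn r hall.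
have [->|[a aA]] := set_0Vmem A; first by exists (fun=> u0) => [t|t];
  rewrite inE.
have ltA S : S \proper A -> (#|S| < n)%N by move=> /proper_card/leq_trans;
  apply.
case: (boolP [exists S : {set T}, [&& S \proper A, S != set0 & #|nbhd r S| <=
  #|S|]%N]).
  case/existsP => S /and3P[ltSA S0 leS]; have sSA := proper_sub ltSA.
  have [f1 f1inj f1r] : exists2 f : T -> U,
      {in S &, injective f} & {in S, forall t, r t (f t)}.
    by apply: IHn => [|S' sS']; [exact: ltA | apply/hall/(subset_trans sS')].
  (* With [S] tight, a set [S'] disjoint from it keeps at least [#|S'|] neighbours outside
     [nbhd r S], by Hall's condition for the union of [S] and [S']. *)
  have [|S' sS'|f2 f2inj f2r] := IHn (A :\: S) _ (fun t u =>
    r t u && (u \notin nbhd r S)).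
  - apply: ltA; rewrite properEneq subsetDl andbT.
    apply: contraNneq S0 => eqA; rewrite -subset0; apply/subsetP => t tS.
    by have := subsetP sSA t tS; rewrite -eqA inE tS.
  - have /subsetDP[sS'A dS'] := sS'.
    have := hall (S :|: S'); rewrite subUset sSA sS'A => /(_ isT).
    rewrite cardsU disjoint_setI0 1?disjoint_sym // cards0 subn0 => leU.
    rewrite -(leq_add2l #|S|); apply: leq_trans leU _.
    rewrite -leq_subLR; set N' := nbhd _ S'.
    suff /subset_leq_card : nbhd r (S :|: S') \subset nbhd r S :|: N'.
      by move=> le; have := cardsU (nbhd r S) N'; lia.
    apply/subsetP => u /nbhdP[t]; rewrite !inE => /orP[] tS rtu.
      by apply/orP; left; apply/exists_inP; exists t.
    case: (boolP [exists _ in _, _]) => //= nu; apply/exists_inP; exists t =>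
      //.
    by rewrite rtu.
  pose f t := if t \in S then f1 t else f2 t.
  have f2' t : t \in A -> t \notin S -> r t (f2 t) /\ f2 t \notin nbhd r S.
    by move=> tA tS; apply/andP; apply: f2r; rewrite inE tS.
  have f1' t : t \in S -> f1 t \in nbhd r S.
    by move=> tS; apply/nbhdP; exists t; rewrite ?f1r.
  exists f => [t t' tA t'A|t tA]; rewrite /f; last first.
    by case: ifPn => [/f1r|/(f2' t tA)[]].
  case: ifPn => tS; case: ifPn => t'S E.
  - exact: f1inj.
  - by have := f1' _ tS; rewrite E (negPf (f2' _ t'A t'S).2).
  - by have := f1' _ t'S; rewrite -E (negPf (f2' _ tA tS).2).
  - by apply: f2inj; rewrite // inE ?tS ?t'S.
(* Without tight subsets, every nonempty proper subset has a spare neighbour, so [a] may take any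
   neighbour [b] and Hall's condition survives the removal of [b]. *)
move/existsPn => tight.
have [b rab] : exists b, r a b.
  have /card_gt0P[b /nbhdP[t]] : (0 < #|nbhd r [set a]|)%N.
    by apply: leq_trans (hall _ _); rewrite ?cards1 ?sub1set.
  by rewrite inE => /eqP ->; exists b.
have pA : A :\ a \proper A by rewrite properD1.
have [|S sS|f finj fr] := IHn (A :\ a) _ (fun t u => r t u && (u != b)).
- exact: ltA.
- have [->|S0] := eqVneq S set0; first by rewrite cards0.
  have := tight S; rewrite S0 (sub_proper_trans sS pA) /= -ltnNge.
  have -> : nbhd (fun t u => r t u && (u != b)) S = nbhd r S :\ b.
    apply/setP => u; rewrite !inE; apply/exists_inP/andP =>
      [[t tS /andP[rtu ub]]|[ub]].
      by split=> //; apply/exists_inP; exists t.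
    by case/exists_inP => t tS rtu; exists t => //; rewrite rtu.
  by have := cardsD1 b (nbhd r S); case: (b \in _) => /=; lia.
exists (fun t => if t == a then b else f t) => [t t' tA t'A|t tA].
  case: eqVneq => [->|ta]; case: eqVneq => [->|t'a] // E.
  - by have := fr t'; rewrite !inE t'a t'A -E eqxx andbF => /(_ isT).
  - by have := fr t; rewrite !inE ta tA E eqxx andbF => /(_ isT).
  - by apply: finj; rewrite // !inE ?ta ?t'a.
by case: eqVneq => [->|ta] //; have := fr t; rewrite !inE ta tA =>
  /(_ isT)/andP[].
Qed.

End Hall.

(** A set violating Hall's condition is paired with the complement of its neighbourhood. This form
    is symmetric in the two sides, so that later either of the two sets can serve as the set of
    rows. *)
Lemma perfect_matching_or_violator (B : finType) (r : rel B) :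
  (exists t : {perm B}, forall a, r a (t a)) \/
  (exists A' B' : {set B}, (#|B| < #|A'| + #|B'|)%N /\
     {in A' & B', forall a b, ~~ r a b}).
Proof.
case: (pickP (@predT B)) => [b0 _|B0]; last first.
  by left; exists 1%g => a; have := B0 a.
case: (boolP [forall S : {set B}, #|S| <= #|nbhd r S|]%N) => [/forallP hall|].
  have [S _|f finj fr] := @Hall_marriage _ _ b0 r [set: B]; first exact: hall.
  left; exists (perm (fun a b => finj a b (in_setT a) (in_setT b))) => a.
  by rewrite permE; apply: fr; rewrite inE.
case/forallPn => S; rewrite -ltnNge => ltS; right; exists S, (~: nbhd r S).
split; first by have := cardsC (nbhd r S); have := subset_leq_card (subsetT S);
  lia.
by move=> a b aS; rewrite !inE; apply: contra => rab; apply/exists_inP;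
  exists a.
Qed.

(** * Matching vertices with disjoint random neighbourhoods *)

Section RandomRows.
Variables (R : realFieldType) (p : R).
Hypothesis p01 : 0 <= p <= 1.
Variables (B P : finType).
Implicit Types (s : {ffun P -> bool}) (w : {ffun B * P -> bool}).
Implicit Types (t : B -> {ffun P -> bool}) (D : {set B}).

Let q0 : 0 <= 1 - p. Proof. by rewrite subr_ge0; case/andP: p01. Qed.

Lemma bernoulli_pow n : 1 - n%:R * p <= (1 - p) ^+ n.
Proof.
case/andP: p01 => p0 p1; elim: n => [|n IHn]; first by rewrite mul0r subr0.
rewrite exprS; apply: le_trans (ler_wpM2l q0 IHn).
rewrite -subr_ge0 -natr1.
have -> : (1 - p) * (1 - n%:R * p) - (1 - (n%:R + 1) * p) = n%:R * p ^+ 2 by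
  ring.
by rewrite mulr_ge0 // sqr_ge0.
Qed.

Definition supp s : {set P} := [set v | s v].

Definition meets s s' : bool := [exists v, s v && s' v].

Lemma meetsC s s' : meets s s' = meets s' s.
Proof. by apply: eq_existsb => v; rewrite andbC. Qed.

Lemma missE s s' : ~~ meets s s' = [forall v in supp s', ~~ s v].
Proof.
rewrite negb_exists; apply: eq_forallb => v.
by rewrite inE negb_and implybE orbC.
Qed.

Lemma Ex_miss s' : Ex p (fun s => (~~ meets s s')%:R) = (1 - p) ^+ #|supp s'|.
Proof. by rewrite -Ex_all_false; apply: eq_Ex => s; rewrite missE. Qed.

Lemma Ex_miss2 s1 s2 :
  Ex p (fun s => (~~ meets s s1)%:R * (~~ meets s s2)%:R) =
  (1 - p) ^+ #|supp s1 :|: supp s2|.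
Proof.
rewrite -Ex_all_false; apply: eq_Ex => s; rewrite -natrM mulnb !missE.
congr (nat_of_bool _)%:R; apply/andP/forall_inP =>
  [[/forall_inP h1 /forall_inP h2] v|h].
  by rewrite inE => /orP[/h1|/h2].
by split; apply/forall_inP => v vs; apply: h; rewrite inE vs ?orbT.
Qed.

(* Second moment method for the number Z of missed sets, in the form
   [Z = 0] <= (1 - Z / E Z)^2. *)
Lemma Ex_meets_all t (B' : {set B}) (rho del : R) l :
    0 < rho -> (0 < #|B'|)%N ->
    {in B', forall b, rho <= (1 - p) ^+ #|supp (t b)|} ->
    {in B' &, forall b b', b != b' -> (#|supp (t b) :&: supp (t b')| <= l)%N} ->
    l%:R * p <= del -> del <= 2^-1 ->
  Ex p (fun s => [forall b in B', meets s (t b)]%:R) <=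
    (rho * #|B'|%:R)^-1 + 2 * del.
Proof.
move=> rho0 B0 hrho hl ldel del2.
have del0 : 0 <= del.
  by apply: le_trans ldel; rewrite mulr_ge0 //; case/andP: p01.
pose r b := (1 - p) ^+ #|supp (t b)|; pose m1 := \sum_(b in B') r b.
have r0 b : 0 <= r b by rewrite exprn_ge0.
have m1ge : rho * #|B'|%:R <= m1.
  rewrite mulr_natr -sumr_const; exact: ler_sum.
have m1gt : 0 < m1 by apply: lt_le_trans m1ge; rewrite mulr_gt0 ?ltr0n.
pose Z s : R := \sum_(b in B') (~~ meets s (t b))%:R.
have EZ : Ex p Z = m1.
  by rewrite /Z Ex_sum; apply: eq_bigr => b _; rewrite Ex_miss.
(* The diagonal contributes [m1]. Off the diagonal, the two misses are correlated only through the
   intersection of the sets, which costs a factor of at most [(1 - del)^-1 <= 1 + 2 * del]. *)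
have EZ2 : Ex p (fun s => Z s * Z s) <= m1 + (1 + 2 * del) * m1 ^+ 2.
  under eq_Ex do rewrite /Z big_distrlr /=.
  rewrite Ex_sum; under eq_bigr => b _ do rewrite Ex_sum.
  have -> : m1 + (1 + 2 * del) * m1 ^+ 2 =
      \sum_(b in B') (r b + (1 + 2 * del) * \sum_(b' in B') r b * r b').
    by rewrite big_split -mulr_sumr expr2 /m1 big_distrlr.
  apply: ler_sum => b bB.
  have off b' : b' \in B' -> b' != b ->
      Ex p (fun s => (~~ meets s (t b))%:R * (~~ meets s (t b'))%:R) <=
      (1 + 2 * del) * (r b * r b').
    move=> b'B neb; rewrite Ex_miss2; set u := (1 - p) ^+ _.
    have u0 : 0 <= u by rewrite exprn_ge0.
    have -> : r b * r b' = u * (1 - p) ^+ #|supp (t b) :&: supp (t b')|.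
      rewrite -!exprD; congr (_ ^+ _).
      by rewrite cardsUI.
    have : 1 - del <= (1 - p) ^+ #|supp (t b) :&: supp (t b')|.
      apply: le_trans (bernoulli_pow _); rewrite lerD2l lerN2.
      apply: le_trans ldel; rewrite ler_wpM2r ?ler_nat ?hl //;
        first by case/andP: p01.
      by rewrite eq_sym.
    set c := (1 - p) ^+ _ => hc; rewrite mulrCA ler_peMr //.
    apply: (@le_trans _ _ ((1 + 2 * del) * (1 - del))); first by nra.
    by rewrite ler_wpM2l // addr_ge0 // mulr_ge0.
  rewrite (bigD1 b) //= lerD //; first by rewrite Ex_miss2 setUid.
  rewrite mulr_sumr [leRHS](bigD1 b) //= ler_wpDl //.
    by rewrite !mulr_ge0 // addr_ge0 // mulr_ge0.
  by apply: ler_sum => b' /andP[]; exact: off.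
apply: (@le_trans _ _ (Ex p (fun s => 1 + (- (2 * m1^-1) * Z s + m1^-2 * (Z s *
  Z s))))).
  apply: le_Ex => // s.
  have -> : 1 + (- (2 * m1^-1) * Z s + m1^-2 * (Z s * Z s)) = (1 - m1^-1 * Z s)
    ^+ 2.
    by rewrite -exprVn; ring.
  case: (boolP [forall b in B', _]) => [/forall_inP all|_]; last exact: sqr_ge0.
  have -> : Z s = 0 by apply: big1 => b /all ->.
  by rewrite mulr0 subr0 expr1n.
rewrite !ExD !ExZ Ex_cst EZ.
apply: (@le_trans _ _ (m1^-1 + 2 * del)); last first.
  by rewrite lerD2r lef_pV2 // posrE // mulr_gt0 ?ltr0n.
have : m1^-2 * Ex p (fun s => Z s * Z s) <= m1^-2 * (m1 + (1 + 2 * del) * m1 ^+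
  2).
  by rewrite ler_wpM2l // invr_ge0 exprn_ge0 // ltW.
have -> : m1^-2 * (m1 + (1 + 2 * del) * m1 ^+ 2) = m1^-1 + (1 + 2 * del).
  by field; rewrite gt_eqF.
have -> : - (2 * m1^-1) * m1 = -2 by field; rewrite gt_eqF.
by lra.
Qed.

(** Degrees are controlled through the chance of missing a row, codegrees by [l]: these are the
    inputs of the second moment bound. *)
Definition good_rows (rho : R) l t : bool :=
  [forall b, rho <= (1 - p) ^+ #|supp (t b)|] &&
  [forall b, forall b', (b != b') ==> (#|supp (t b) :&: supp (t b')| <= l)%N].

(** A Hall violator whose first set fills at least half of [B]. The rows in [D] are left out,
    because there an incompatibility may come from a ban instead of from [meets]. *)
Definition deficient D t w : bool :=
  [exists A' : {set B}, exists B' : {set B},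
    [&& #|B| <= 2 * #|A'|, #|B| < #|A'| + #|B'| &
        [forall a in A' :\: D, forall b in B', meets (bitrow w a) (t b)]]%N].

(** Lower-tail Chernoff bound: Markov's inequality for [2^-1] to the number of missing rows, which
    factors over the independent rows. *)
Lemma Ex_few_missing t D (rho : R) tau b :
    0 <= rho <= 1 -> rho <= (1 - p) ^+ #|supp (t b)| ->
  Ex p (fun w => (#|[set a | (a \notin D) && ~~ meets (bitrow w a) (t b)]| <
    tau)%N%:R)
    <= 2 ^+ tau * (1 - rho / 2) ^+ #|~: D|.
Proof.
move=> /andP[rho0 rho1] hb.
pose g a s : R := if (a \notin D) && ~~ meets s (t b) then 2^-1 else 1.
apply: (@le_trans _ _ (Ex p (fun w => 2 ^+ tau * \prod_a g a (bitrow w a)))).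
  apply: le_Ex => // w; rewrite -big_mkcond; set S := [set a | _].
  rewrite -(eq_bigl _ _ (fun a => in_set _ a)) -/S prodr_const.
  set c := #|_|; case: ltnP => [ltc|_]; last by rewrite mulr_ge0 // exprn_ge0
    // invr_ge0.
  by rewrite exprVn ler_pdivlMr ?exprn_gt0 // mul1r ler_weXn2l ?ler1n // ltnW.
rewrite ExZ Ex_rows ler_wpM2l ?exprn_ge0 //.
rewrite -prodr_const [leRHS]big_mkcond; apply: ler_prod => a _; apply/andP;
  split.
  by apply: Ex_ge0 => // s; rewrite /g; case: ifP; rewrite ?invr_ge0.
rewrite inE /g; case: ifP => _ /=; last by rewrite Ex_cst.
apply: (@le_trans _ _ (Ex p (fun s => 1 + - 2^-1 * (~~ meets s (t b))%:R))).
  by apply: le_Ex => // s; case: meets => /=; lra.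
by rewrite ExD ExZ Ex_cst Ex_miss; lra.
Qed.

(** If [B'] has fewer than [tau] elements, any [b] in it is missed by too few rows, since those
    outside [D] lie in the complement of [A']. Otherwise the second moment bound applies to each row
    of [A' :\: D], with a union bound over all pairs [(A', B')]. *)
Lemma Ex_deficient t D (rho del : R) l tau :
    0 < rho <= 1 -> (0 < tau)%N -> good_rows rho l t ->
    l%:R * p <= del -> del <= 2^-1 -> (rho * tau%:R)^-1 + 2 * del <= 4^-1 ^+ 8
      ->
    (4 * #|D| <= #|B|)%N ->
  Ex p (fun w => (deficient D t w)%:R) <=
    #|B|%:R * (2 ^+ tau * (1 - rho / 2) ^+ #|~: D|) + 4^-1 ^+ #|B|.
Proof.
move=> /andP[rho0 rho1] tau0 /andP[/forallP good1 /forallP good2] ldel del2 hK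
  hD.
pose low b w := (#|[set a | (a \notin D) && ~~ meets (bitrow w a) (t b)]| <
  tau)%N.
pose big (AB : {set B} * {set B}) w :=
  [&& #|B| <= 2 * #|AB.1|, tau <= #|AB.2| &
     [forall a in AB.1 :\: D, forall b in AB.2, meets (bitrow w a) (t b)]]%N.
apply: (@le_trans _ _ (Ex p (fun w => \sum_b (low b w)%:R + \sum_AB (big AB
  w)%:R))).
  apply: le_Ex => // w.
  apply: le_trans (lerD (natr_exists _ _) (natr_exists _ _)).
  case: (boolP (deficient D t w)) => [/existsP[A' /existsP[B' /and3P[hA hAB
    /forall_inP all]]]|_]; last exact: addr_ge0.
  have [tauB|Btau] := leqP tau #|B'|.
    rewrite -[leLHS]add0r lerD // (_ : [exists AB, _] = true) //.
    by apply/existsP; exists (A', B'); rewrite /big /= hA tauB /=;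
      apply/forall_inP.
  rewrite -[leLHS]addr0 lerD // (_ : [exists b, _] = true) //.
  have /card_gt0P[b bB'] : (0 < #|B'|)%N.
    have leA : (#|A'| <= #|B|)%N by exact: max_card.
    by rewrite lt0n; apply: contraTneq hAB => ->; rewrite addn0 -leqNgt.
  apply/existsP; exists b; rewrite /low; apply: leq_ltn_trans Btau.
  apply: (@leq_trans #|~: A'|); last by rewrite -(leq_add2l #|A'|) cardsC ltnW.
  apply/subset_leq_card/subsetP => a; rewrite !inE => /andP[aD];
    apply: contra => aA.
  have aAD : a \in A' :\: D by rewrite inE aD.
  exact: (forall_inP (all a aAD)).
rewrite ExD !Ex_sum lerD //.
  rewrite mulr_natl -sumr_const; apply: ler_sum => b _.
  by apply: Ex_few_missing; rewrite ?rho1 ?(ltW rho0) ?good1.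
have step (AB : {set B} * {set B}) : Ex p (fun w =>
  (big AB w)%:R) <= 4^-1 ^+ (2 * #|B|).
  case: AB => A' B'; rewrite /big /=.
  case: (boolP (#|B| <= 2 * #|A'|)%N) => hA /=;
    last by rewrite Ex_cst exprn_ge0 // invr_ge0.
  case: (boolP (tau <= #|B'|)%N) => hB /=; last by rewrite Ex_cst exprn_ge0 //
    invr_ge0.
  pose g a s : R := if a \in A' :\: D then [forall b in B', meets s (t b)]%:R
    else 1.
  have -> : Ex p (fun w => [forall a in A' :\: D, forall b in B', meets (bitrow
    w a) (t b)]%:R)
      = Ex p (fun w => \prod_a g a (bitrow w a)).
    apply: eq_Ex => w; rewrite /g; case: (boolP [forall a in _, _]) =>
      [/forall_inP all|].
      by rewrite big1 // => a _; case: ifP => // /all ->.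
    by case/forall_inPn => a aA /negPf ne; rewrite (bigD1 a) //= aA ne mul0r.
  rewrite Ex_rows.
  apply: (@le_trans _ _ ((4^-1 ^+ 8) ^+ #|A' :\: D|)).
    rewrite -prodr_const [leRHS]big_mkcond; apply: ler_prod => a _; apply/andP;
      split.
      by apply: Ex_ge0 => // s; rewrite /g; case: ifP; rewrite ?invr_ge0.
    rewrite /g; case: ifP => aA; last by rewrite Ex_cst.
    have B'0 : (0 < #|B'|)%N by apply: leq_trans hB.
    apply: le_trans (Ex_meets_all rho0 B'0 _ _ ldel del2) (le_trans _ hK) => //.
    - by move=> b b' _ _ ne; apply: (implyP (forallP (good2 b) b')).
    - rewrite lerD2r lef_pV2 ?posrE ?mulr_gt0 ?ltr0n //.
      by rewrite ler_wpM2l ?ler_nat // ltW.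
  rewrite -exprM ler_wiXn2l ?invr_ge0 ?invf_le1 ?ler1n //.
  (* At least a quarter of [B] remains in [A' :\: D], so the exponent 8 of [4^-1 ^+ 8] yields [4^-1]
     to the power [2 * #|B|]; half of that exponent pays for the [4 ^ #|B|] pairs. *)
  have cD : (#|A' :&: D| <= #|D|)%N by exact/subset_leq_card/subsetIr.
  have arith i c d a n : (i + c = a -> i <= d -> n <= 2 * a -> 4 * d <= n ->
    2 * n <= 8 * c)%N by clear; lia.
  exact: arith (cardsID D A') cD hA hD.
apply: le_trans (ler_sum _ (fun AB _ => step AB)) _.
rewrite sumr_const card_prod.
have -> : #|{set B}| = (2 ^ #|B|)%N.
  have := card_powerset [set: B]; rewrite cardsT => <-.
  by apply: eq_card => S; rewrite !inE subsetT.
rewrite -expnMn -[leLHS]mulr_natr natrX mul2n -addnn exprD -mulrA -exprMn.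
have -> : 4^-1 * (2 * 2)%:R = 1 :> R by rewrite mulVf ?pnatr_eq0.
by rewrite expr1n mulr1.
Qed.

(** Upper-tail Chernoff bound: a degree [d] is too large exactly when [rho * (1 - p) ^- d] exceeds
    1, and Markov's inequality is applied to the [k]-th power of this quantity. *)
Lemma Ex_thick_row (rho : R) k b : p < 1 -> 0 <= rho ->
  Ex p (fun w => (~~ (rho <= (1 - p) ^+ #|supp (bitrow w b)|))%:R) <=
    rho ^+ k * (1 + p * ((1 - p) ^- k - 1)) ^+ #|P|.
Proof.
move=> p1 rho0; have q_gt0 : 0 < 1 - p by rewrite subr_gt0.
rewrite (Ex_row (B := B) p b (fun s => (~~ (rho <= (1 - p) ^+ #|supp s|))%:R)).
rewrite -cardsT -Ex_exp_card -ExZ; apply: le_Ex => // s.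
rewrite -ltNge; have -> : [set i in [set: P] | s i] = supp s.
  by apply/setP => v; rewrite !inE.
case: ltP => [lt|_]; last by rewrite mulr_ge0 ?exprn_ge0 ?invr_ge0 ?exprn_ge0.
rewrite exprVn -exprM mulnC exprM ler_pdivlMr ?exprn_gt0 // mul1r.
by apply: lerXn2r; rewrite ?nnegrE ?exprn_ge0 // ltW.
Qed.

(** Markov's inequality for 2 to the power of the codegree; the columns are independent and each
    contributes the mean [1 + p ^+ 2]. *)
Lemma Ex_thick_intersection l b b' : b != b' ->
  Ex p (fun w => (~~ (#|supp (bitrow w b) :&: supp (bitrow w b')| <= l)%N)%:R)
    <=
    2^-1 ^+ l * (1 + p ^+ 2) ^+ #|P|.
Proof.
move=> neb.
(* The matrix is transposed so that [Ex_rows] applies to its columns. *)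
pose h (u : {ffun P * B -> bool}) : R :=
  \prod_v (if bitrow u v b && bitrow u v b' then 2 else 1).
apply: (@le_trans _ _ (2^-1 ^+ l * Ex p h)); last first.
  rewrite ler_wpM2l ?exprn_ge0 ?invr_ge0 //.
  rewrite (Ex_rows p (fun _ (c : {ffun B -> bool}) =>
    if c b && c b' then 2 else 1)).
  rewrite prodr_const (_ : Ex _ _ = 1 + p ^+ 2) //.
  transitivity (Ex p (fun c : {ffun B -> bool} =>
      1 + [forall i in [set b; b'], c i]%:R)); last first.
    by rewrite ExD Ex_cst Ex_all_true cards2 neb.
  apply: eq_Ex => c.
  have -> : [forall i in [set b; b'], c i] = c b && c b'.
    apply/forall_inP/andP => [all|[cb cb'] i];
      first by rewrite !all // !inE eqxx ?orbT.
    by rewrite !inE => /orP[]/eqP->.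
  by case: ifP => _ /=; ring.
rewrite -(Ex_marginal (I := (B * P)%type) p (phi := fun vb => (vb.2, vb.1)) h);
  last first.
  by case=> [? ?] [? ?] [-> ->].
rewrite -ExZ; apply: le_Ex => // w; set S := supp _ :&: _.
have -> : h [ffun j => w (j.2, j.1)] = 2 ^+ #|S|.
  rewrite /h -big_mkcond -prodr_const; apply: eq_bigl => v.
  by rewrite !inE !ffunE.
rewrite -ltnNge; case: ltnP => [lt|_]; last by rewrite mulr_ge0 ?exprn_ge0
  ?invr_ge0.
by rewrite exprVn ler_pdivlMl ?exprn_gt0 // mulr1 ler_weXn2l ?ler1n // ltnW.
Qed.

Lemma Ex_bad_rows (rho : R) l k : p < 1 -> 0 <= rho ->
  Ex p (fun w => (~~ good_rows rho l (bitrow w))%:R) <=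
    #|B|%:R * (rho ^+ k * (1 + p * ((1 - p) ^- k - 1)) ^+ #|P|) +
    #|B|%:R ^+ 2 * (2^-1 ^+ l * (1 + p ^+ 2) ^+ #|P|).
Proof.
move=> p1 rho0.
apply: (@le_trans _ _ (Ex p (fun w =>
   \sum_b (~~ (rho <= (1 - p) ^+ #|supp (bitrow w b)|))%:R +
   \sum_b \sum_b' ((b != b') &&
     ~~ (#|supp (bitrow w b) :&: supp (bitrow w b')| <= l)%N)%:R))).
  apply: le_Ex => // w; rewrite negb_and.
  set X := ~~ [forall b, rho <= _]; set Y := ~~ _.
  apply: (@le_trans _ _ (X%:R + Y%:R)); first by case: X; case: Y => //=; lra.
  rewrite lerD // /X /Y negb_forall; first exact: natr_exists.
  apply: le_trans (natr_exists _ _) _; apply: ler_sum => b _.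
  rewrite negb_forall; apply: le_trans (natr_exists _ _) _; apply: ler_sum =>
    b' _.
  by rewrite negb_imply.
rewrite ExD !Ex_sum lerD //.
  by rewrite mulr_natl -sumr_const; apply: ler_sum => b _; exact: Ex_thick_row.
rewrite expr2 -mulrA mulr_natl -sumr_const; apply: ler_sum => b _.
rewrite Ex_sum mulr_natl -sumr_const; apply: ler_sum => b' _.
have [_|neb] := eqVneq b b'; last exact: Ex_thick_intersection.
by rewrite Ex_cst mulr_ge0 ?exprn_ge0 ?invr_ge0 // addr_ge0 // sqr_ge0.
Qed.

(** [DA] and [DB] encode the ban on pairing touched vertices of the two graphs; both are empty in
    the bipartite case. *)
Definition has_matching (DA DB : {set B}) (x y : {ffun B * P -> bool}) : bool :=
  [exists t : {perm B}, forall a, ~~ meets (bitrow x a) (bitrow y (t a)) &&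
     ~~ ((a \in DA) && (t a \in DB))].

(** One of the two sets of a Hall violator fills at least half of [B]. Once the banned rows are
    removed from it, only [meets] can explain the incompatible pairs. *)
Lemma no_matching_cases (DA DB : {set B}) x y : ~~ has_matching DA DB x y ->
  deficient DA (bitrow y) x || deficient DB (bitrow x) y.
Proof.
have [[t ht] /existsPn/(_ t)/forallPn[a]|[A' [B' [ltB bad]]] _] :=
  perfect_matching_or_violator (fun a b =>
    ~~ meets (bitrow x a) (bitrow y b) && ~~ ((a \in DA) && (b \in DB))).
  by rewrite ht.
have [leA|ltA] := leqP #|B| (2 * #|A'|).
  apply/orP; left; apply/existsP; exists A'; apply/existsP; exists B'.
  rewrite leA ltB; apply/forall_inP => a; rewrite inE => /andP[aD aA].
  apply/forall_inP => b bB; have := bad a b aA bB.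
  by rewrite negb_and !negbK (negPf aD) orbF.
apply/orP; right; apply/existsP; exists B'; apply/existsP; exists A'.
have arith a b n : (n < a + b -> 2 * a < n -> n <= 2 * b)%N by clear; lia.
rewrite (arith _ _ _ ltB ltA) addnC ltB; apply/forall_inP => b.
rewrite inE => /andP[bD bB]; apply/forall_inP => a aA; have := bad a b aA bB.
by rewrite negb_and !negbK (negPf bD) andbF orbF meetsC.
Qed.

(** One matrix is frozen with good rows while the other stays random. Doing this for both roles of
    [x] and [y] gives the two factors 2. *)
Lemma Ex_no_matching (DA DB : {set B}) (rho del : R) l tau k :
    p < 1 -> 0 < rho <= 1 -> (0 < tau)%N ->
    l%:R * p <= del -> del <= 2^-1 -> (rho * tau%:R)^-1 + 2 * del <= 4^-1 ^+ 8
      ->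
    (4 * #|DA| <= #|B|)%N -> (4 * #|DB| <= #|B|)%N ->
  Ex p (fun x => Ex p (fun y => (~~ has_matching DA DB x y)%:R)) <=
    2 * (#|B|%:R * (rho ^+ k * (1 + p * ((1 - p) ^- k - 1)) ^+ #|P|) +
         #|B|%:R ^+ 2 * (2^-1 ^+ l * (1 + p ^+ 2) ^+ #|P|)) +
    2 * (#|B|%:R * (2 ^+ tau * (1 - rho / 2) ^+ #|B|./2) + 4^-1 ^+ #|B|).
Proof.
move=> p1 rho01 tau0 ldel del2 hK hA hB; have /andP[rho0 rho1] := rho01.
set bad := (X in 2 * X + _); set def := (X in _ + 2 * X).
have def0 : 0 <= def.
  by rewrite addr_ge0 ?mulr_ge0 ?exprn_ge0 ?invr_ge0 //; lra.
have Ebad : Ex p (fun w => (~~ good_rows rho l (bitrow w))%:R) <= bad.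
  by apply: Ex_bad_rows => //; exact: ltW.
have Edef (D : {set B}) (w : {ffun B * P -> bool}) : (4 * #|D| <= #|B|)%N ->
   Ex p (fun w' => (good_rows rho l (bitrow w) && deficient D (bitrow w)
     w')%:R) <= def.
  move=> hD; case: (boolP (good_rows _ _ _)) => [good|_] /=;
    last by rewrite Ex_cst.
  apply: le_trans (Ex_deficient rho01 tau0 good ldel del2 hK hD) _.
  rewrite lerD2r ler_wpM2l // ler_wpM2l ?exprn_ge0 // ler_wiXn2l //; [lra|lra|].
  have arith d d' n : (d + d' = n -> 4 * d <= n -> n./2 <= d')%N by clear; lia.
  exact: arith (cardsC D) hD.
apply: (@le_trans _ _ (Ex p (fun x => Ex p (fun y =>
    (~~ good_rows rho l (bitrow x))%:R +
    ((~~ good_rows rho l (bitrow y))%:R +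
    ((good_rows rho l (bitrow y) && deficient DA (bitrow y) x)%:R +
     (good_rows rho l (bitrow x) && deficient DB (bitrow x) y)%:R)))))).
  apply: le_Ex => // x; apply: le_Ex => // y.
  case: (boolP (has_matching _ _ _ _)) => [_|/no_matching_cases] /=.
    by rewrite !addr_ge0.
  move: (good_rows rho l (bitrow x)) (good_rows rho l (bitrow y)).
  move: (deficient DA (bitrow y) x) (deficient DB (bitrow x) y).
  by move=> [] [] [] [] //= _; lra.
under eq_Ex do rewrite !ExD Ex_cst.
rewrite !ExD Ex_cst.
have E1 : Ex p (fun x => Ex p (fun y =>
    (good_rows rho l (bitrow y) && deficient DA (bitrow y) x)%:R)) <= def.
  rewrite Ex_exchange -[leRHS](Ex_cst p (B * P)%type).
  by apply: le_Ex => // y; exact: Edef.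
have E2 : Ex p (fun x => Ex p (fun y =>
    (good_rows rho l (bitrow x) && deficient DB (bitrow x) y)%:R)) <= def.
  rewrite -[leRHS](Ex_cst p (B * P)%type).
  by apply: le_Ex => // x; exact: Edef.
rewrite [2 * bad]mulr_natl [2 * def]mulr_natl !mulr2n -addrA.
exact: lerD Ebad (lerD Ebad (lerD E1 E2)).
Qed.

End RandomRows.

(** * Packing block by block *)

Section Packing.
Variable V : finType.
Implicit Types (A C : {set V}) (x y : {ffun {set V} -> bool}) (s : {perm V}).

(** Being the identity off [A], [s] permutes [A]; partial bijections are thus handled as
    permutations of [V]. *)
Definition packs A x y s : bool :=
  perm_on A s && [forall u in A, forall v in A, (u != v) ==>
    ~~ (x [set u; v] && y [set s u; s v])].

Definition packable A x y : bool := [exists s, packs A x y s].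

Definition touched C x : {set V} :=
  [set a in C | [exists a' in C, (a != a') && x [set a; a']]].

Definition cross A C : {set {set V}} := [set [set a; v] | a in C, v in A].

Lemma cross_disjoint A C (e : {set V}) : [disjoint A & C] ->
  e \subset A \/ e \subset C -> e \notin cross A C.
Proof.
move=> dAC sub; apply/imset2P => -[a v aC vA eE].
have [ae ve] : a \in e /\ v \in e by rewrite eE !inE !eqxx orbT.
case: sub => /subsetP sub.
  by have := disjointFr dAC (sub _ ae); rewrite aC.
by have := disjointFr dAC vA; rewrite (sub _ ve).
Qed.

Lemma set2_subset (u v : V) A : u \in A -> v \in A -> [set u; v] \subset A.
Proof. by move=> uA vA; rewrite subUset !sub1set uA. Qed.

Lemma cross_inj A C (a a' v v' : V) : [disjoint A & C] ->
  a \in C -> a' \in C -> v \in A -> v' \in A ->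
  [set a; v] = [set a'; v'] -> a = a' /\ v = v'.
Proof.
move=> dAC aC a'C vA v'A E.
have neq w w' : w \in A -> w' \in C -> w == w' = false.
  by move=> wA w'C; apply: contraTF w'C => /eqP <-; rewrite (disjointFr dAC wA).
split; apply/eqP.
  by have := set21 a v; rewrite E !inE [a == v']eq_sym (neq v' a) ?orbF.
by have := set22 a v; rewrite E !inE (neq v a').
Qed.

(** The new permutation is [s] off [C] and [t] on [C]. Column [v] of the second matrix reads [y'] at
    [s v], so a column [v] common to the rows [a] and [t a] is exactly a conflict at the pair [a],
    [v]. *)
Lemma packs_extend A C x y x' y' s : [disjoint A & C] -> packs A x y s ->
    has_matching [set a : {v | v \in C} | val a \in touched C x]
      [set b : {v | v \in C} | val b \in touched C y]
      [ffun av : {v | v \in C} * {v | v \in A} => x' [set val av.1; val av.2]]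
      [ffun bv : {v | v \in C} * {v | v \in A} => y' [set val bv.1;
        s (val bv.2)]] ->
  packable (A :|: C) (mix (~: cross A C) x x') (mix (~: cross A C) y y').
Proof.
move=> dAC /andP[sA /forall_inP pk] /existsP[t /forallP ht].
have sAE v : (s v \in A) = (v \in A) by apply: perm_closed.
pose f v := if insub v is Some c then val (t c) else s v.
have fC v (vC : v \in C) : f v = val (t (Sub v vC)) by rewrite /f insubT.
have fNC v : v \notin C -> f v = s v by move=> vC;
  rewrite /f insubF // (negPf vC).
have fA v : v \in A -> f v = s v by move=> vA;
  rewrite fNC // (disjointFr dAC vA).
have fCC v : v \in C -> f v \in C by move=> vC; rewrite fC; exact: valP.
have sNC v : v \notin C -> s v \notin C.
  move=> vC; have [vA|vA] := boolP (v \in A).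
    by rewrite (disjointFr dAC) // sAE.
  by rewrite (out_perm sA vA).
have finj : injective f.
  move=> u v; have [uC|uC] := boolP (u \in C); have [vC|vC] := boolP (v \in C).
  - by rewrite !fC => /val_inj/perm_inj[].
  - by move=> E; have := fCC _ uC; rewrite E fNC // (negPf (sNC _ vC)).
  - by move=> E; have := fCC _ vC; rewrite -E fNC // (negPf (sNC _ uC)).
  - by rewrite !fNC // => /perm_inj.
have mixin w w' e : e \notin cross A C -> mix (~: cross A C) w w' e = w e.
  by move=> ne; rewrite ffunE inE ne.
have mixout w w' e : e \in cross A C -> mix (~: cross A C) w w' e = w' e.
  by move=> ie; rewrite ffunE inE ie.
have mixed u v : u \in C -> v \in A ->
    ~~ (mix (~: cross A C) x x' [set u; v] && mix (~: cross A C) y y' [set f u;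
      f v]).
  move=> uC vA; rewrite !mixout; last 2 first.
  - by apply/imset2P; exists (f u) (f v); rewrite ?fCC // fA ?sAE.
  - by apply/imset2P; exists u v.
  have /andP[/existsPn/(_ (Sub v vA)) + _] := ht (Sub u uC).
  by rewrite !ffunE /= fC fA.
apply/existsP; exists (perm finj); apply/andP; split.
  apply/subsetP => u; rewrite inE permE; apply: contraR; rewrite !inE negb_or.
  by case/andP=> uA uC; rewrite fNC // (out_perm sA uA).
apply/forall_inP => u uAC; apply/forall_inP => v vAC; apply/implyP => uv.
rewrite !permE; move: uAC vAC; rewrite !inE => /orP[uA|uC] /orP[vA|vC].
- rewrite !fA // !mixin; first by apply: (implyP (forall_inP (pk u uA) v vA)).
    by apply: cross_disjoint => //; left; rewrite set2_subset ?sAE.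
  by apply: cross_disjoint => //; left; exact: set2_subset.
- by rewrite setUC [[set f u; f v]]setUC; exact: mixed.
- exact: mixed.
rewrite !mixin; last 2 first.
- by apply: cross_disjoint => //; right; apply: set2_subset; exact: fCC.
- by apply: cross_disjoint => //; right; exact: set2_subset.
(* A conflict inside [C] would make [u] touched in [x] and its image touched in [y], which is a
   banned pair. *)
have /andP[_] := ht (Sub u uC); apply: contra => /andP[xuv yuv].
rewrite !inE /= -fC uC fCC //=; apply/andP; split; apply/exists_inP.
  by exists v; rewrite // uv.
by exists (f v); [exact: fCC | rewrite (inj_eq finj) uv].
Qed.

Lemma card_touched C x :
  (#|touched C x| <= 2 * #|[set e in [set [set a;
    a'] | a in C, a' in C] | x e]|)%N.
Proof.
set E := [set e in _ | _].
have sub : touched C x \subset cover E.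
  apply/subsetP => a; rewrite inE => /andP[aC /exists_inP[a' a'C /andP[_ xaa]]].
  apply/bigcupP; exists [set a; a']; last by rewrite !inE eqxx.
  by rewrite inE xaa andbT; apply/imset2P; exists a a'.
apply: leq_trans (subset_leq_card sub) _.
rewrite mulnC -sum_nat_const.
apply: leq_trans (leq_card_cover E) _; apply: leq_sum => e.
rewrite inE => /andP[/imset2P[a a' _ _ ->] _].
by rewrite cards2; case: (_ != _).
Qed.

End Packing.

(** * Failure probability of the block construction *)

Section RandomPacking.
Variables (R : realFieldType) (p : R).
Hypothesis p01 : 0 <= p <= 1.
Variable V : finType.
Implicit Types A C : {set V}.

Definition unpackable_prob A : R :=
  Ex p (fun x => Ex p (fun y => (~~ packable A x y)%:R)).

(** Markov's inequality for [256 ^+ m], with [m] counting the true bits on pairs from [C]: if more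
    than a quarter of [C] is touched then [#|C| < 8 * m], and 256 is [2 ^+ 8]. *)
Lemma Ex_many_touched C :
  Ex p (fun x => (#|C| < 4 * #|touched C x|)%N%:R) <=
    2^-1 ^+ #|C| * (1 + p * 255) ^+ (#|C| * #|C|).
Proof.
set F := [set [set a; a'] | a in C, a' in C].
have cardF : (#|F| <= #|C| * #|C|)%N.
  by rewrite -cardsX /F curry_imset2X; exact: leq_imset_card.
apply: (@le_trans _ _ (2^-1 ^+ #|C| * (1 + p * (256 - 1)) ^+ #|F|)).
  rewrite -Ex_exp_card -ExZ; apply: le_Ex => // x.
  have := card_touched C x; rewrite -/F; set m := #|[set e in F | x e]| => lem.
  case: ltnP => [lt|_]; last by rewrite mulr_ge0 ?exprn_ge0 ?invr_ge0.
  rewrite exprVn ler_pdivlMl ?exprn_gt0 // mulr1.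
  have -> : 256 = 2 ^+ 8 :> R by rewrite -natrX.
  rewrite -exprM.
  rewrite ler_weXn2l ?ler1n //; move: lt lem; clear.
  by move: #|C| #|touched C x| => a b; lia.
case/andP: p01 => p0 _.
have -> : 256 - 1 = 255 :> R by ring.
rewrite ler_wpM2l ?exprn_ge0 ?invr_ge0 // ler_weXn2l //.
by rewrite lerDl mulr_ge0.
Qed.

(** Everything but the cross edges is exposed first. Too large a touched set costs [th] for each
    graph; otherwise a packing [s] of [A] is fixed, and the cross edges, still fresh, fail to extend
    it with probability at most [q]. *)
Lemma unpackable_prob_step A C (th q : R) : [disjoint A & C] -> 0 <= q ->
    Ex p (fun x => (#|C| < 4 * #|touched C x|)%N%:R) <= th ->
    (forall DA DB : {set {v | v \in C}},
       (4 * #|DA| <= #|C|)%N -> (4 * #|DB| <= #|C|)%N ->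
       Ex p (fun x : {ffun {v | v \in C} * {v | v \in A} -> bool} =>
         Ex p (fun y => (~~ has_matching DA DB x y)%:R)) <= q) ->
  unpackable_prob (A :|: C) <= unpackable_prob A + (th + (th + q)).
Proof.
move=> dAC q0 hth hq; set S := ~: cross A C.
have -> : unpackable_prob (A :|: C) = Ex p (fun x => Ex p (fun y =>
    Ex p (fun x' => Ex p (fun y' => (~~ packable (A :|: C) (mix S x x') (mix S
      y y'))%:R)))).
  rewrite /unpackable_prob [LHS](Ex_resample p S); apply: eq_Ex => x.
  rewrite [RHS]Ex_exchange; apply: eq_Ex => x'.
  exact: (Ex_resample p S (fun y => (~~ packable (A :|: C) (mix S x x') y)%:R)).
pose big x := (#|C| < 4 * #|touched C x|)%N.
apply: (@le_trans _ _ (Ex p (fun x => Ex p (fun y =>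
    (~~ packable A x y)%:R + ((big x)%:R + ((big y)%:R + q)))))); last first.
  under eq_Ex do rewrite !ExD !Ex_cst.
  by rewrite !ExD !Ex_cst lerD2l lerD // lerD.
apply: le_Ex => // x; apply: le_Ex => // y.
have le1 : Ex p (fun x' => Ex p (fun y' =>
   (~~ packable (A :|: C) (mix S x x') (mix S y y'))%:R)) <= 1.
  rewrite -[leRHS](Ex_cst p {set V}); apply: le_Ex => // x'.
  rewrite -[leRHS](Ex_cst p {set V}); apply: le_Ex => // y'.
  by case: packable.
have [bx|bx] := boolP (big x).
  by apply: le_trans le1 _; rewrite addrCA lerDl !addr_ge0.
have [by_|by_] := boolP (big y).
  by apply: le_trans le1 _; rewrite addrA addrCA lerDl !addr_ge0.
have [/existsP[s pk]|_] := boolP (packable A x y); last first.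
  by apply: le_trans le1 _; rewrite lerDl !addr_ge0.
rewrite /= !add0r.
pose DA := [set a : {v | v \in C} | val a \in touched C x].
pose DB := [set b : {v | v \in C} | val b \in touched C y].
have cardD (z : {ffun {set V} -> bool}) :
    (#|[set a : {v | v \in C} | val a \in touched C z]| <= #|touched C z|)%N.
  rewrite -(card_imset _ val_inj); apply/subset_leq_card/subsetP => v.
  by case/imsetP => a; rewrite inE => aT ->.
pose phi (av : {v | v \in C} * {v | v \in A}) := [set val av.1; val av.2].
(* Since [s] depends on [x] and [y] but not on [x'] and [y'], relabelling the columns by [s] leaves
   the fresh bits independent. *)
pose psi (bv : {v | v \in C} * {v | v \in A}) := [set val bv.1; s (val bv.2)].
have sA (v : {v | v \in A}) : s (val v) \in A.
  by rewrite perm_closed; [exact: valP | case/andP: pk].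
have phi_inj : injective phi.
  case=> [a v] [a' v'] /(cross_inj dAC) [] /=; try exact: valP.
  by move=> /val_inj -> /val_inj ->.
have psi_inj : injective psi.
  case=> [a v] [a' v'] /(cross_inj dAC) [] /=; try exact: valP; try exact: sA.
  by move=> /val_inj -> /perm_inj/val_inj ->.
apply: le_trans (hq DA DB _ _); last 2 first.
- by apply: leq_trans (leq_mul (leqnn 4) (cardD x)) _; rewrite leqNgt.
- by apply: leq_trans (leq_mul (leqnn 4) (cardD y)) _; rewrite leqNgt.
rewrite -(Ex_marginal p _ phi_inj); apply: le_Ex => // x'.
rewrite -(Ex_marginal p _ psi_inj); apply: le_Ex => // y'.
case: (boolP (has_matching _ _ _ _)) => [hm|_]; last by case: packable.
by rewrite (packs_extend dAC pk hm).
Qed.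

Lemma ex_subset_card A m : (m <= #|A|)%N -> exists2 C : {set V}, C \subset A &
  #|C| = m.
Proof.
move=> mA; exists [set v in take m (enum A)].
  by apply/subsetP => v; rewrite inE => /mem_take; rewrite mem_enum.
rewrite cardsE; have /card_uniqP -> := take_uniq m (enum_uniq (mem A)).
by rewrite size_take -cardE; case: ltngtP mA.
Qed.

Lemma unpackable_prob0 : unpackable_prob set0 = 0.
Proof.
rewrite /unpackable_prob -[RHS](Ex_cst p {set V}); apply: eq_Ex => x.
rewrite -[RHS](Ex_cst p {set V}); apply: eq_Ex => y.
have -> // : packable set0 x y.
apply/existsP; exists 1%g; rewrite /packs perm_on1.
by apply/forall_inP => u; rewrite inE.
Qed.

(** Blocks of size [m] are peeled off until fewer than [2 * m] vertices remain, which form one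
    block. The number of blocks is bounded crudely by [#|A|]. *)
Lemma unpackable_prob_blocks (q : R) m : (0 < m)%N -> 0 <= q ->
    (forall A C, [disjoint A & C] -> (m <= #|C| < 2 * m)%N ->
       unpackable_prob (A :|: C) <= unpackable_prob A + q) ->
  forall A, (m <= #|A|)%N -> unpackable_prob A <= #|A|%:R * q.
Proof.
move=> m0 q0 step A; elim: {A}_.+1 {-2}A (ltnSn #|A|) => // n IHn A leAn mA.
have [A2|A2] := ltnP #|A| (2 * m).
  have := step set0 A; rewrite disjoints_subset sub0set mA A2 set0U
    unpackable_prob0.
  move=> /(_ isT isT); rewrite add0r => /le_trans; apply.
  by rewrite ler_peMl // ler1n; exact: leq_trans mA.
have [C CA cardC] := ex_subset_card mA.
have cardD : (#|A :\: C| + m = #|A|)%N.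
  by rewrite -cardC addnC -(cardsID C A) (setIidPr CA).
have dD : [disjoint A :\: C & C] by rewrite -setI_eq0 setDE -setIA [_ :&:
  C]setIC setICr setI0.
have := step _ _ dD; rewrite cardC leqnn ltn_Pmull //= => /(_ isT).
rewrite setDE setUIl (setUidPl CA) setUC setUCr setIT -setDE => /le_trans;
  apply.
rewrite -cardD natrD mulrDl lerD //; last by rewrite ler_peMl // ler1n.
by apply: IHn; move: cardD A2 leAn m0; clear; move: #|A| #|A :\: C| => a d; lia.
Qed.

End RandomPacking.

(** * Random subgraphs as independent bits *)

Section SubgraphBits.
Variables (R : realFieldType) (p : R).
Hypothesis p01 : 0 <= p <= 1.
Variables (V : finType) (H : sgraph V).
Implicit Types x : {ffun {set V} -> bool}.

Lemma edge_card2 (G : sgraph V) e : e \in edges G -> #|e| = 2.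
Proof. by case: G => E /= /forall_inP + eE => /(_ e eE)/eqP. Qed.

Lemma bits_graph_subproof x : [forall e in [set e in edges H | x e], #|e| == 2].
Proof.
by apply/forall_inP => e; rewrite inE => /andP[/edge_card2 -> _].
Qed.

Definition bits_graph x : sgraph V := SGraph (bits_graph_subproof x).

Lemma adj_bits_graph x u v :
  adj (bits_graph x) u v = adj H u v && x [set u; v].
Proof. by rewrite /adj inE. Qed.

(** Bits off [edges H] are drawn but ignored; the bits producing a given subgraph [G] of [H] form a
    cylinder on [edges H]. *)
Lemma subgraph_law_bits (g : sgraph V -> R) :
  \sum_G subgraph_law H p G * g G = Ex p (fun x => g (bits_graph x)).
Proof.
rewrite /Ex [RHS](partition_big bits_graph xpredT) //=; apply: eq_bigr => G _.
transitivity ((\sum_(x | bits_graph x == G) bits_law p x) * g G); last first.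
  by rewrite mulr_suml; apply: eq_bigr => x /eqP->.
congr (_ * _); rewrite /subgraph_law; case: ifPn => [sub|nsub]; last first.
  rewrite big_pred0 // => x; apply: contraNF nsub => /eqP <-.
  by apply/subsetP => e; rewrite inE => /andP[].
pose u : {ffun {set V} -> bool} := [ffun e => e \in edges G].
transitivity (\prod_(e in edges H) bit_law p (u e)).
  by apply: eq_bigr => e _; rewrite ffunE.
rewrite -Ex_cylinder [RHS]big_mkcond; apply: eq_bigr => x _.
rewrite (_ : [forall e in _, _] = (bits_graph x == G)).
  by case: eqP; rewrite ?mulr1 ?mulr0.
rewrite -val_eqE /=; apply/forall_inP/eqP => [eqx|E e eH].
  apply/setP => e; rewrite inE; have [eH|eH] := boolP (e \in edges H) => /=.
    by rewrite (eqP (eqx e eH)) ffunE.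
  by apply/esym; apply: contraNF eH; exact: subsetP.
by rewrite ffunE -E inE eH.
Qed.

Lemma pair_prob_bits (A : sgraph V -> sgraph V -> bool) :
  pair_prob H p A =
  1 - Ex p (fun x => Ex p (fun y => (~~ A (bits_graph x) (bits_graph y))%:R)).
Proof.
apply/eqP; rewrite eq_sym subr_eq; apply/eqP.
have -> : pair_prob H p A =
    Ex p (fun x => Ex p (fun y => (A (bits_graph x) (bits_graph y))%:R)).
  rewrite -(subgraph_law_bits (fun X => Ex p (fun y =>
    (A X (bits_graph y))%:R))).
  apply: eq_bigr => X _; rewrite -(subgraph_law_bits (fun Y => (A X Y)%:R)).
  rewrite big_distrr [LHS]big_mkcond; apply: eq_bigr => Y _ /=.
  by case: (A X Y); rewrite ?mulr1 ?mulr0.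
rewrite -ExD -[LHS](Ex_cst p {set V}); apply: eq_Ex => x.
rewrite -ExD -[LHS](Ex_cst p {set V}); apply: eq_Ex => y.
by case: (A _ _); rewrite ?addr0 ?add0r.
Qed.

Lemma pair_prob_le1 (A : sgraph V -> sgraph V -> bool) : pair_prob H p A <= 1.
Proof.
by rewrite pair_prob_bits gerBl; do 2![apply: Ex_ge0 => // ?].
Qed.

End SubgraphBits.

(** * From packings and matchings to isolated vertices *)

Lemma FS_isolated (V : finType) (X Y : sgraph V) (s : {perm V}) :
  (forall a b, adj X a b -> ~~ adj Y (s a) (s b)) -> FS_has_isolated X Y.
Proof.
move=> disj; apply/existsP; exists s; apply/forallP => t; rewrite adj_FS.
apply/existsP => -[a /existsP[b /and3P[Xab Yab _]]].
by have := disj a b Xab; rewrite Yab.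
Qed.

Lemma pair_prob_complete (R : realFieldType) (p : R) (V : finType) :
    0 <= p <= 1 ->
  1 - unpackable_prob p [set: V] <=
    pair_prob (complete V) p (@FS_has_isolated V).
Proof.
move=> p01; rewrite pair_prob_bits lerD2l lerN2.
apply: le_Ex => // x; apply: le_Ex => // y.
case: (boolP (packable _ _ _)) => [/existsP[s /andP[_ /forall_inP pk]]|_];
  last first.
  by case: FS_has_isolated.
rewrite (@FS_isolated _ _ _ s) // => a b; rewrite !adj_bits_graph =>
  /andP[ab xab].
have := forall_inP (pk a (in_setT a)) b (in_setT b).
have -> : a != b by move/edge_card2: ab; rewrite cards2; case: (a != b).
by rewrite xab /= andbC => /negPf ->.
Qed.

Definition matching_fail_prob (R : realFieldType) (p : R) (B P : finType) : R :=
  Ex p (fun x : {ffun B * P -> bool} =>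
    Ex p (fun y => (~~ has_matching set0 set0 x y)%:R)).

(** Rows are indexed by the right part, columns by the left part. The bijection is the identity on
    the left, so equal column labels in [x] and [y] denote matched vertices. No edge lies inside a
    part, hence nothing is banned. *)
Lemma pair_prob_bipartite (R : realFieldType) (p : R) (A B : finType) :
    0 <= p <= 1 ->
  1 - matching_fail_prob p B A <=
    pair_prob (complete_bipartite A B) p (@FS_has_isolated (A + B)%type).
Proof.
move=> p01; rewrite pair_prob_bits lerD2l lerN2 /matching_fail_prob.
pose phi (bv : B * A) : {set A + B} := [set inr bv.1; inl bv.2].
have phi_inj : injective phi.
  case=> [b v] [b' v'] E.
  have := set21 (inr b : A + B)%type (inl v); rewrite -[[set _;
    _]]/(phi (b, v)) E.
  have := set22 (inr b : A + B)%type (inl v); rewrite -[[set _;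
    _]]/(phi (b, v)) E.
  by rewrite !inE /= ?orbF => /eqP[->] /eqP[->].
rewrite -(Ex_marginal p _ phi_inj); apply: le_Ex => // x.
rewrite -(Ex_marginal p _ phi_inj); apply: le_Ex => // y.
case: (boolP (has_matching _ _ _ _)) => [/existsP[t /forallP ht]|_]; last first.
  by case: FS_has_isolated.
pose f (u : A + B) : A + B := match u with inl v => inl v | inr b =>
  inr (t b) end.
have finj : injective f.
  by case=> [u|u] [v|v] //= -[/perm_inj->].
have key b v : ~~ (x [set inr b; inl v] && y [set inr (t b); inl v]).
  have /andP[/existsPn/(_ v) + _] := ht b.
  by rewrite !ffunE.
rewrite (@FS_isolated _ _ _ (perm finj)) // => a b.
rewrite !adj_bits_graph !permE => /andP[+ xab]; rewrite negb_and.
rewrite adj_rel_graph => [|[?|?] [?|?] //].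
move: a b xab => [u|u] [v|v] /= xab; rewrite ?andbF // => _; apply/orP; right.
  by have := key v u; rewrite setUC xab /= [[set inl u; _]]setUC.
by have := key u v; rewrite xab.
Qed.

(** * Asymptotics *)

From mathcomp Require Import all_classical all_reals all_analysis.

Section Estimates.
Variables (R : realType) (p : R) (k n T : nat).
(** In use, [k] is the integer part of the eighth root of [n], and errors are measured in powers of
    [kap^-1]. The parameters of the matching bound will be [rho = kap^-1], [tau = T * k.+1] and
    [l = k], with blocks of at least [k ^ 3] vertices. *)
Let kap : R := k.+1%:R.
Hypotheses (p01 : 0 <= p <= 1) (T0 : (0 < T)%N) (hT : 2 ^+ 17 <= T%:R :> R).
Hypothesis hexp : expR (64 * (n%:R * p ^+ 2)) <= kap.
Hypothesis hpk : p * k%:R ^+ 3 <= 2^-1 ^+ 18.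
Hypothesis hTk : 16 * (2 * T%:R + 1) <= k%:R :> R.
Hypothesis hkap : kap ^+ 27 <= expR (k%:R / 2).

Let p0 : 0 <= p. Proof. by case/andP: p01. Qed.
Let k1 : 1 <= k%:R :> R.
Proof. by apply: le_trans hTk; have := ler0n R T; lra. Qed.
Let kap1 : 1 <= kap. Proof. by rewrite ler1n. Qed.
Let kap2 : kap <= 2 * k%:R. Proof. by rewrite /kap -natr1; have := k1; lra. Qed.
Let half_pow m : (2^-1 ^+ m : R) <= expR (- (m%:R / 2)).
Proof.
have -> : - (m%:R / 2) = m%:R * (- 2^-1) :> R by ring.
rewrite expRM_natl lerXn2r ?nnegrE ?expR_ge0 ?invr_ge0 //.
by have := expR_ge1Dx (- 2^-1 : R); lra.
Qed.

Let p_small : p <= 2^-1 ^+ 18.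
Proof. by apply: le_trans hpk; rewrite ler_peMr //; exact: exprn_ege1. Qed.

Let pow18 : 2^-1 ^+ 18 * 4096 <= 1 :> R.
Proof.
have -> : 4096 = 2 ^+ 12 :> R by rewrite -natrX.
rewrite (_ : 18 = 6 + 12)%N // exprD -mulrA -exprMn mulVf ?pnatr_eq0 // expr1n
  mulr1.
by apply: exprn_ile1; rewrite ?invr_ge0 // invf_le1 ?ler1n.
Qed.

Let pow1D (c : R) m : 0 <= c -> (1 + c) ^+ m <= expR (m%:R * c).
Proof.
move=> c0; rewrite expRM_natl lerXn2r ?nnegrE ?expR_ge0 ?addr_ge0 //.
exact: expR_ge1Dx.
Qed.

Let exp_kap : expR (- (k%:R / 2)) <= kap ^- 27.
Proof. by rewrite expRN lef_pV2 ?posrE ?expR_gt0 ?exprn_gt0 ?ltr0n. Qed.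

Let kapV_le i j : (i <= j)%N -> kap ^- j <= kap ^- i.
Proof. by move=> ij; rewrite lef_pV2 ?posrE ?exprn_gt0 ?ltr0n // ler_weXn2l.
  Qed.

Section Matching.
Variables (B P : finType).
Hypotheses (hP : (#|P| <= n)%N) (hB3 : (k ^ 3 <= #|B|)%N) (hB8 : (#|B| <= k.+1
  ^ 8)%N).

Let B_le : #|B|%:R <= kap ^+ 8 :> R.
Proof. by rewrite -natrX ler_nat. Qed.

Let B_ge : k%:R ^+ 3 <= #|B|%:R :> R.
Proof. by rewrite -natrX ler_nat. Qed.

(** The bound is [kap ^+ 8 * kap ^- 32 * kap], with room to spare. The 64 of [hexp] comes from
    [(1 - p) ^- 32 - 1 <= 64 * p]. *)
Lemma thick_row_estimate :
  #|B|%:R * (kap^-1 ^+ 32 * (1 + p * ((1 - p) ^- 32 - 1)) ^+ #|P|) <= kap ^- 10.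
Proof.
have p32 : 32 * p <= 2^-1 by have := pow18; have := p_small; lra.
have inv : (1 - p) ^- 32 <= 1 + 64 * p.
  have ge := bernoulli_pow p01 32.
  apply: (@le_trans _ _ (1 - 32 * p)^-1).
    by rewrite lef_pV2 // posrE; [apply: lt_le_trans ge|]; lra.
  by rewrite -[leLHS]mul1r ler_pdivrMr; [have := p0; nra | lra].
have inv1 : 1 <= (1 - p) ^- 32.
  by rewrite invf_ge1 ?exprn_gt0 ?exprn_ile1 //; have := p0; lra.
have pw : (1 + p * ((1 - p) ^- 32 - 1)) ^+ #|P| <= kap.
  apply: le_trans hexp; apply: (@le_trans _ _ ((1 + 64 * p ^+ 2) ^+ #|P|)).
    rewrite lerXn2r ?nnegrE ?addr_ge0 ?mulr_ge0 ?subr_ge0 ?sqr_ge0 //.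
    by rewrite lerD2l mulrC expr2 mulrA ler_wpM2r //; lra.
  apply: le_trans (pow1D _ _) _; first by rewrite mulr_ge0 // sqr_ge0.
  by rewrite ler_expR mulrCA ler_wpM2l // ler_wpM2r ?sqr_ge0 // ler_nat.
have k0 : 0 < kap by rewrite ltr0n.
apply: (@le_trans _ _ (kap ^+ 8 * (kap ^- 32 * kap))).
  apply: ler_pM => //.
    rewrite mulr_ge0 ?exprn_ge0 ?invr_ge0 ?(ltW k0) //.
    by rewrite addr_ge0 // mulr_ge0 // subr_ge0.
  by rewrite exprVn ler_wpM2l // invr_ge0 exprn_ge0 // ltW.
have -> : kap ^+ 8 * (kap ^- 32 * kap) = kap ^- 23 by field; rewrite gt_eqF.
exact: kapV_le.
Qed.

(** This fixes the exponent 27 of [hkap]: [16 - 27 + 1 = -10]. *)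
Lemma thick_intersection_estimate :
  #|B|%:R ^+ 2 * (2^-1 ^+ k * (1 + p ^+ 2) ^+ #|P|) <= kap ^- 10.
Proof.
have k0 : 0 < kap by rewrite ltr0n.
have pw : (1 + p ^+ 2) ^+ #|P| <= kap.
  apply: le_trans hexp; apply: le_trans (pow1D _ _) _; first exact: sqr_ge0.
  rewrite ler_expR; apply: (@le_trans _ _ (n%:R * p ^+ 2)).
    by rewrite ler_wpM2r ?sqr_ge0 // ler_nat.
  by rewrite ler_peMl ?mulr_ge0 ?sqr_ge0 // ler1n.
apply: (@le_trans _ _ ((kap ^+ 8) ^+ 2 * (kap ^- 27 * kap))).
  apply: ler_pM; rewrite ?mulr_ge0 ?exprn_ge0 ?invr_ge0 ?addr_ge0 ?sqr_ge0 //.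
    by rewrite lerXn2r ?nnegrE ?exprn_ge0 // ltW.
  apply: ler_pM; rewrite ?exprn_ge0 ?invr_ge0 ?addr_ge0 ?sqr_ge0 //.
  exact: le_trans (half_pow k) exp_kap.
have -> : (kap ^+ 8) ^+ 2 * (kap ^- 27 * kap) = kap ^- 10 by field;
  rewrite gt_eqF.
exact: lexx.
Qed.

Lemma few_missing_estimate :
  #|B|%:R * (2 ^+ (T * k.+1) * (1 - kap^-1 / 2) ^+ #|B|./2) <= kap ^- 10.
Proof.
have k0 : 0 < kap by rewrite ltr0n.
have V1 : kap^-1 <= 1 by rewrite invf_le1.
have V0 : 0 <= kap^-1 by rewrite invr_ge0 ltW.
have v2 : 0 <= 1 - kap^-1 / 2.
  by move: V0 V1; move: (kap^-1) => v V0 V1; lra.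
have e1 : 2 ^+ (T * k.+1) <= expR (2 * T%:R * k%:R) :> R.
  apply: (@le_trans _ _ ((expR 1 : R) ^+ (T * k.+1))).
    by rewrite lerXn2r ?nnegrE ?expR_ge0 //; have := expR_ge1Dx (1 : R); lra.
  rewrite -expRM_natl ler_expR natrM mulr1 -/kap.
  by have := ler0n R T; have := kap2; nra.
have hB : #|B|%:R <= 4 * (#|B|./2)%:R :> R.
  have k2 : (1 < k)%N.
    by rewrite -(ltr_nat R); have := hTk; have := ler0n R T; lra.
  have B2 : (1 < #|B|)%N.
    apply: (leq_trans k2 (leq_trans _ hB3)).
    by rewrite expnS leq_pmulr // expn_gt0 (ltnW k2).
  have arith b : (1 < b -> b <= 4 * b./2)%N by clear; lia.
  by rewrite -natrM ler_nat; exact: arith.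
(* This uses that [#|B|./2] is at least [k ^ 3 / 4] and that [kap] is at most [2 * k]. *)
have e2 : (1 - kap^-1 / 2) ^+ #|B|./2 <= expR (- (k%:R ^+ 2 / 16)).
  apply: (@le_trans _ _ (expR (- (kap^-1 / 2)) ^+ #|B|./2)).
    by rewrite lerXn2r ?nnegrE ?expR_ge0 ?v2 //; exact: expR_ge1Dx.
  rewrite -expRM_natl ler_expR mulrN lerN2.
  have h : k%:R ^+ 2 / 2 <= k%:R ^+ 3 * kap^-1.
    have hk : 0 <= k%:R ^+ 2 * (2 * k%:R - kap) by rewrite mulr_ge0 ?sqr_ge0
      ?subr_ge0.
    by rewrite ler_pdivlMr //; lra.
  have h2 : k%:R ^+ 3 * kap^-1 <= 4 * (#|B|./2)%:R * kap^-1.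
    by rewrite ler_wpM2r //; apply: le_trans hB.
  by move: h h2; move: (kap^-1) => v h h2; lra.
have e3 : 2 ^+ (T * k.+1) * (1 - kap^-1 / 2) ^+ #|B|./2 <= kap ^- 27.
  apply: le_trans exp_kap.
  apply: (@le_trans _ _ (expR (2 * T%:R * k%:R) * expR (- (k%:R ^+ 2 / 16)))).
    by apply: ler_pM; rewrite ?exprn_ge0.
  (* By [hTk], [k ^ 2 / 16] is at least [(2 * T + 1) * k], so the quadratic decay beats
     [2 ^+ (T * k.+1)]. *)
  rewrite -expRD ler_expR; have := hTk; have := k1; have := ler0n R T; nra.
apply: (@le_trans _ _ (kap ^+ 8 * kap ^- 27)).
  by apply: ler_pM; rewrite ?mulr_ge0 ?exprn_ge0.
have -> : kap ^+ 8 * kap ^- 27 = kap ^- 19 by field; rewrite gt_eqF.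
exact: kapV_le.
Qed.

Lemma quarter_estimate : 4^-1 ^+ #|B| <= kap ^- 10.
Proof.
apply: (@le_trans _ _ (2^-1 ^+ #|B|)).
  by rewrite lerXn2r ?nnegrE ?invr_ge0 // lef_pV2 ?posrE // ler_nat.
apply: le_trans (half_pow _) _; apply: le_trans (kapV_le (isT : 10 <= 27)%N).
apply: le_trans exp_kap; rewrite ler_expR lerN2 ler_wpM2r ?invr_ge0 //.
by apply: le_trans B_ge; rewrite -[leLHS]expr1 ler_weXn2l.
Qed.

Lemma no_matching_estimate (DA DB : {set B}) :
    (4 * #|DA| <= #|B|)%N -> (4 * #|DB| <= #|B|)%N ->
  Ex p (fun x : {ffun B * P -> bool} =>
    Ex p (fun y => (~~ has_matching DA DB x y)%:R)) <= 8 * kap ^- 10.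
Proof.
move=> hA hB.
have k0 : 0 < kap by rewrite ltr0n.
have tau0 : (0 < T * k.+1)%N by rewrite muln_gt0 T0.
have rho01 : 0 < kap^-1 <= 1 by rewrite invr_gt0 k0 invf_le1.
have p1 : p < 1 by have := pow18; have := p_small; lra.
have kp : k%:R * p <= 2^-1 ^+ 18.
  apply: le_trans hpk; rewrite mulrC ler_wpM2l // -[leLHS]expr1.
  by rewrite ler_weXn2l.
have d2 : 2^-1 ^+ 18 <= 2^-1 :> R by have := pow18; lra.
(* The budget [4^-1 ^+ 8 = 2^-1 ^+ 16] is shared equally: [rho * tau = T] is at least [2 ^+ 17], and
   [del = 2^-1 ^+ 18] counts twice. *)
have hK : (kap^-1 * (T * k.+1)%:R)^-1 + 2 * 2^-1 ^+ 18 <= 4^-1 ^+ 8 :> R.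
  have -> : kap^-1 * (T * k.+1)%:R = T%:R.
    by rewrite natrM mulrCA mulVf ?mulr1 // gt_eqF.
  have TV : T%:R^-1 <= 2^-1 ^+ 17 :> R.
    by rewrite exprVn lef_pV2 // posrE ?exprn_gt0 // ltr0n.
  have -> : 4^-1 ^+ 8 = 2^-1 ^+ 17 + 2 * 2^-1 ^+ 18 :> R by field.
  by rewrite lerD2r.
apply: le_trans (Ex_no_matching p01 P 32 p1 rho01 tau0 kp d2 hK hA hB) _.
have := thick_row_estimate; have := thick_intersection_estimate.
have := few_missing_estimate; have := quarter_estimate.
set a1 := 4^-1 ^+ _; set a2 := #|B|%:R * (2 ^+ _ * _).
set a3 := #|B|%:R ^+ 2 * _; set a4 := #|B|%:R * _; set c := kap ^- 10.
by move: a1 a2 a3 a4 c => a1 a2 a3 a4 c; lra.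
Qed.

End Matching.

(** By [hpk] the mean degree inside a block is tiny, so the generating function is at most
    [expR (#|C| / 4)] and loses against [2^-1 ^+ #|C| <= expR (- (#|C| / 2))]. *)
Lemma touched_estimate (V : finType) (C : {set V}) :
    (k ^ 3 <= #|C| < 2 * k ^ 3)%N ->
  Ex p (fun x => (#|C| < 4 * #|touched C x|)%N%:R) <= kap ^- 10.
Proof.
case/andP=> C1 C2; apply: le_trans (Ex_many_touched p01 C) _.
have c1 : k%:R ^+ 3 <= #|C|%:R :> R by rewrite -natrX ler_nat.
have c2 : #|C|%:R <= 2 * k%:R ^+ 3 :> R by rewrite -natrX -natrM ler_nat ltnW.
apply: (@le_trans _ _ (expR (- (#|C|%:R / 2)) * expR (#|C|%:R / 4))).
  apply: ler_pM; rewrite ?exprn_ge0 ?invr_ge0 ?addr_ge0 ?mulr_ge0 ?half_pow //.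
  apply: le_trans (pow1D _ _) _; first by rewrite mulr_ge0.
  rewrite ler_expR natrM -mulrA ler_wpM2l //.
  have h : #|C|%:R * p <= 2 * 2^-1 ^+ 18.
    apply: (@le_trans _ _ (2 * k%:R ^+ 3 * p)); first by rewrite ler_wpM2r.
    by rewrite -mulrA [_ * p]mulrC ler_wpM2l.
  by have := pow18; lra.
rewrite -expRD; apply: le_trans (kapV_le (isT : 10 <= 27)%N).
apply: le_trans exp_kap; rewrite ler_expR.
have : 2 * k%:R <= k%:R ^+ 3 :> R.
  rewrite [k%:R ^+ 3]exprSr ler_wpM2r //; have : 16 <= k%:R :> R.
    by have := hTk; have := ler0n R T; lra.
  by nra.
by lra.
Qed.

(** A block costs [(1 + 1 + 8) * kap ^- 10], and there are fewer than [kap ^+ 8] blocks. *)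
Lemma unpackable_estimate (V : finType) : #|V| = n -> (k ^ 8 <= n)%N ->
  (n < k.+1 ^ 8)%N -> unpackable_prob p [set: V] <= 10 * kap ^- 2.
Proof.
move=> Vn n1 n2.
have k0 : (0 < k)%N by rewrite -(ltr0n R); have := k1; lra.
have kap0 : 0 < kap by rewrite ltr0n.
have m0 : (0 < k ^ 3)%N by rewrite expn_gt0 k0.
have q0 : 0 <= 10 * kap ^- 10 by rewrite mulr_ge0 // invr_ge0 exprn_ge0 // ltW.
apply: (@le_trans _ _ (#|[set: V]|%:R * (10 * kap ^- 10))).
  apply: (unpackable_prob_blocks m0 q0) => [A C dAC hC|]; last first.
    by rewrite cardsT Vn; apply: leq_trans n1; rewrite leq_pexp2l.
  apply: le_trans (unpackable_prob_step (q := 8 * kap ^- 10) p01 dAC _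
    (touched_estimate hC) _) _.
  - by rewrite mulr_ge0 // invr_ge0 exprn_ge0 // ltW.
  - have cC : #|{: {v | v \in C}}| = #|C| by rewrite card_sig; apply: eq_card.
    have /andP[hC1 _] := hC.
    move=> DA DB hA hB; apply: no_matching_estimate; rewrite ?cC //.
      by rewrite card_sig -Vn; exact: max_card.
    by apply: leq_trans (ltnW n2); rewrite -Vn max_card.
  - by rewrite lerD2l; move: (kap ^- 10) => c; lra.
rewrite cardsT Vn; apply: (@le_trans _ _ (kap ^+ 8 * (10 * kap ^- 10))).
  by rewrite ler_wpM2r // -natrX ler_nat ltnW.
by have -> : kap ^+ 8 * (10 * kap ^- 10) = 10 * kap ^- 2 by field;
  rewrite gt_eqF.
Qed.

Lemma matching_fail_estimate (B P : finType) : #|B| = n -> #|P| = n ->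
    (k ^ 8 <= n)%N -> (n < k.+1 ^ 8)%N ->
  matching_fail_prob p B P <= 10 * kap ^- 2.
Proof.
move=> Bn Pn n1 n2; apply: (@le_trans _ _ (8 * kap ^- 10)).
  apply: no_matching_estimate; rewrite ?cards0 ?muln0 ?Pn ?Bn // ?(ltnW n2) //.
  apply: leq_trans n1; rewrite leq_pexp2l //.
  by rewrite -(ltr0n R); have := k1; lra.
apply: ler_pM; rewrite ?invr_ge0 ?exprn_ge0 ?ler_nat ?(le_trans ler01 kap1) //.
exact: kapV_le.
Qed.

End Estimates.

(** * Choice of the scale [k] and of the constant *)

Lemma expR_ge_pow (R : realType) (x : R) m : 0 <= x ->
  (x / m.+1%:R) ^+ m.+1 <= expR x.
Proof.
move=> x0; have {2}-> : x = m.+1%:R * (x / m.+1%:R).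
  by rewrite mulrCA divff ?mulr1 // pnatr_eq0.
rewrite expRM_natl lerXn2r ?nnegrE ?expR_ge0 ?divr_ge0 //.
by apply: le_trans (expR_ge1Dx _); rewrite lerDr.
Qed.

(** Eighth roots suit blocks of size [k ^ 3]: short enough for [p * k ^ 3] to be small, long enough
    for the decay [expR (- (k ^ 2 / 16))]. *)
Lemma eighth_root n : exists k, (k ^ 8 <= n < k.+1 ^ 8)%N.
Proof.
elim: n => [|n [k /andP[le lt]]]; first by exists 0%N.
have [lt'|le'] := ltnP n.+1 (k.+1 ^ 8); first by exists k; rewrite lt' leqW.
exists k.+1; rewrite le' (leq_ltn_trans lt) // ltn_exp2r //.
Qed.

Section LargeK.
Variables (R : realType) (p : R) (k n : nat).
Hypotheses (p01 : 0 <= p <= 1) (hk : 2 ^+ 36 <= k%:R :> R).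
Hypotheses (n1 : (k ^ 8 <= n)%N) (n2 : (n < k.+1 ^ 8)%N).
Hypothesis hp : p < 32^-1 * Num.sqrt (ln n%:R / n%:R).

Let k_gt0 : 0 < k%:R :> R.
Proof. by apply: lt_le_trans hk; rewrite exprn_gt0. Qed.

Let n_ge1 : 1 <= n%:R :> R.
Proof.
by rewrite ler1n; apply: leq_trans n1; rewrite expn_gt0 -(ltr0n R) k_gt0.
Qed.

Lemma sqr_edge_prob : n%:R * p ^+ 2 <= ln n%:R / 1024.
Proof.
have n0 : 0 < n%:R :> R by apply: lt_le_trans n_ge1.
have ln0 : 0 <= ln n%:R / n%:R :> R by rewrite divr_ge0 ?ln_ge0.
have p0 : 0 <= p by case/andP: p01.
have : p ^+ 2 <= (32^-1 * Num.sqrt (ln n%:R / n%:R)) ^+ 2.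
  by rewrite lerXn2r ?nnegrE ?mulr_ge0 ?invr_ge0 ?sqrtr_ge0 // ltW.
rewrite exprMn sqr_sqrtr // => h.
apply: le_trans (ler_wpM2l (ltW n0) h) _.
by rewrite le_eqVlt; apply/orP; left; apply/eqP; field; rewrite gt_eqF.
Qed.

Lemma ln_kap : ln n%:R <= 8 * ln (k.+1%:R : R).
Proof.
rewrite mulr_natl -lnXn ?ltr0n // ler_ln ?posrE ?exprn_gt0 ?ltr0n //.
  by rewrite -natrX ler_nat ltnW.
by rewrite -(ltr0n R) (lt_le_trans ltr01).
Qed.

(** The constant [32^-1] enters here: [64 * 8 / 32 ^ 2 = 1 / 2] is at most 1. *)
Lemma exp_edge_prob : expR (64 * (n%:R * p ^+ 2)) <= k.+1%:R.
Proof.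
rewrite -[leRHS]lnK ?posrE ?ltr0n // ler_expR.
have := sqr_edge_prob; have := ln_kap.
have : 0 <= ln (k.+1%:R : R) by rewrite ln_ge0 // ler1n.
move: (ln k.+1%:R) (ln n%:R) (n%:R * p ^+ 2) => a b c; lra.
Qed.

Lemma edge_prob_small : p * k%:R ^+ 3 <= 2^-1 ^+ 18.
Proof.
have p0 : 0 <= p by case/andP: p01.
have k1 : 1 <= k%:R :> R by rewrite ler1n -(ltr0n R).
(* Squared and multiplied by [k ^ 2], the claim compares [k ^ 8 * p ^ 2], which is at most
   [n * p ^ 2] and hence at most [k / 64], with [k ^ 2 / 2 ^ 36]. *)
rewrite -(@ler_pXn2r _ 2) ?nnegrE ?mulr_ge0 ?exprn_ge0 ?invr_ge0 ?ler0n //.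
have lnk : ln (k.+1%:R : R) <= 2 * k%:R.
  apply: le_trans (ltW (ln_sublinear _)) _; rewrite ?ltr0n // -natr1; lra.
have : k%:R ^+ 8 * p ^+ 2 <= n%:R * p ^+ 2.
  by rewrite ler_wpM2r ?sqr_ge0 // -natrX ler_nat.
have := sqr_edge_prob; have := ln_kap => h1 h2 h3.
have h : k%:R ^+ 8 * p ^+ 2 <= k%:R / 64.
  by move: h1 h2 h3 lnk; move: (ln k.+1%:R) (ln n%:R) (n%:R * p ^+ 2) (_ * p ^+
    2) => a b c d; lra.
rewrite -(ler_pM2r (exprn_gt0 2 k_gt0)).
have -> : (p * k%:R ^+ 3) ^+ 2 * k%:R ^+ 2 = k%:R ^+ 8 * p ^+ 2 by ring.
apply: le_trans h _; rewrite -exprM exprVn ler_pdivlMl ?exprn_gt0 //.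
have k640 : 0 <= k%:R / 64 :> R by have := ltW k_gt0; lra.
have k64k : k%:R / 64 <= k%:R :> R by have := ltW k_gt0; lra.
apply: (le_trans (ler_wpM2r k640 hk)).
by rewrite expr2 ler_wpM2l ?ler0n.
Qed.

End LargeK.
Lemma large_k (R : realType) : exists T K0 : nat,
  [/\ (0 < T)%N, 2 ^+ 17 <= T%:R :> R &
   forall k, (K0 <= k)%N ->
   [/\ 2 ^+ 36 <= k%:R :> R, 16 * (2 * T%:R + 1) <= k%:R :> R &
       k.+1%:R ^+ 27 <= expR (k%:R / 2) :> R]].
Proof.
pose T := Num.bound (2 ^+ 17 : R); have hT : 2 ^+ 17 < T%:R :> R.
  by apply: archi_boundP; rewrite exprn_ge0.
(* Chosen so that [a <= k] gives [(2 * k) ^ 27 <= (k / 56) ^ 28], where [56 = 2 * 28]. *)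
pose a := 2 ^+ 27 * 56 ^+ 28 : R.
have a0 : 0 <= a by rewrite mulr_ge0 ?exprn_ge0.
have b0 : 0 <= 2 ^+ 36 :> R by rewrite exprn_ge0.
have c0 : 0 <= 16 * (2 * T%:R + 1) :> R by rewrite mulr_ge0 ?addr_ge0 ?mulr_ge0.
pose K0 := Num.bound (a + (2 ^+ 36 + 16 * (2 * T%:R + 1))).
exists T, K0; split; [|exact: ltW|].
  by rewrite -(ltr0n R); apply: lt_trans hT; rewrite exprn_gt0.
move=> k; rewrite -(ler_nat R) => leK.
have : a + (2 ^+ 36 + 16 * (2 * T%:R + 1)) <= k%:R.
  by apply: le_trans leK; apply/ltW/archi_boundP; rewrite !addr_ge0.
move: (2 ^+ 36 : R) (16 * (2 * T%:R + 1) : R) b0 c0 => b c b0 c0 hk.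
have ak : a <= k%:R by lra.
split; [lra|lra|].
have k1 : 1 <= k%:R :> R.
  by apply: le_trans ak; rewrite mulr_ege1 // exprn_ege1 // ler1n.
have kap2 : k.+1%:R <= 2 * k%:R :> R by rewrite -natr1; lra.
have k2 : 0 <= k%:R / 2 :> R by lra.
apply: le_trans (expR_ge_pow 27 k2).
apply: (@le_trans _ _ ((2 * k%:R) ^+ 27)).
  by rewrite lerXn2r ?nnegrE ?mulr_ge0.
have -> : k%:R / 2 / 28 = k%:R / 56 :> R by field.
rewrite [leRHS]exprMn exprVn ler_pdivlMr ?exprn_gt0 // exprMn mulrAC -/a.
by rewrite exprS ler_wpM2r ?exprn_ge0.
Qed.

(** [K0] is chosen before [p], so the bound still applies when [p] varies with [n]. *)
Lemma FS_isolated_lower_bound (R : realType) : exists K0 : nat,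
  forall k n (p : R), (K0 <= k)%N -> (k ^ 8 <= n)%N -> (n < k.+1 ^ 8)%N ->
    0 <= p <= 1 -> p < 32^-1 * Num.sqrt (ln n%:R / n%:R) ->
  1 - 10 * k.+1%:R ^- 2 <= pair_prob (complete 'I_n) p (@FS_has_isolated 'I_n)
    /\
  1 - 10 * k.+1%:R ^- 2 <= pair_prob (complete_bipartite 'I_n 'I_n) p
     (@FS_has_isolated ('I_n + 'I_n)%type).
Proof.
have [T [K0 [T0 hT large]]] := large_k R; exists K0 => k n p kK n1 n2 p01 hp.
have [k36 kT kexp] := large k kK.
have e1 := exp_edge_prob p01 k36 n1 n2 hp.
have e2 := edge_prob_small p01 k36 n1 n2 hp.
split.
  apply: le_trans (pair_prob_complete _ p01); rewrite lerD2l lerN2.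
  by apply: (unpackable_estimate p01 T0 hT e1 e2 kT kexp) => //;
    exact: card_ord.
apply: le_trans (pair_prob_bipartite _ _ p01); rewrite lerD2l lerN2.
by apply: (matching_fail_estimate p01 T0 hT e1 e2 kT kexp) => //;
  exact: card_ord.
Qed.

(** * Passage to the limit *)

Import numFieldNormedType.Exports.
Local Open Scope classical_set_scope.
Local Open Scope ring_scope.

Theorem theorem1p1 (R : realType) :
  exists eps : R, 0 < eps /\
    forall p : nat -> R,
      (forall n, 0 <= p n <= 1) ->
      (\forall n \near \oo, p n < eps * Num.sqrt (ln n%:R / n%:R)) ->
      (pair_prob (complete 'I_n) (p n) (@FS_has_isolated 'I_n)
         @[n --> \oo] --> (1 : R)) /\
      (pair_prob (complete_bipartite 'I_n 'I_n) (p n)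
         (@FS_has_isolated ('I_n + 'I_n)%type) @[n --> \oo] --> (1 : R)).
Proof.
exists 32^-1; split=> [|p p01 hp]; first by rewrite invr_gt0.
have [K0 bound] := FS_isolated_lower_bound R.
have key (e : R) : 0 < e -> \forall n \near \oo,
    1 - e <= pair_prob (complete 'I_n) (p n) (@FS_has_isolated 'I_n) /\
    1 - e <= pair_prob (complete_bipartite 'I_n 'I_n) (p n)
       (@FS_has_isolated ('I_n + 'I_n)%type).
  (* The second term of the maximum gives [10 / k.+1 <= e], so that the error [10 / k.+1 ^ 2] is at
     most [e]. *)
  move=> e0; pose K := maxn K0 (Num.bound (10 / e)).
  near=> n; have [k /andP[n1 n2]] := eighth_root n.
  have Kk : (K <= k)%N.
    have : (K ^ 8 <= n)%N by near: n; exact: nbhs_infty_ge.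
    by move=> /leq_ltn_trans/(_ n2); rewrite ltn_exp2r // ltnS.
  have pn : p n < 32^-1 * Num.sqrt (ln n%:R / n%:R) by near: n.
  have small : 10 * k.+1%:R ^- 2 <= e.
    have k0 : 0 < k.+1%:R :> R by rewrite ltr0n.
    rewrite ler_pdivrMr ?exprn_gt0 // mulrC -ler_pdivrMr //.
    apply: (@le_trans _ _ k.+1%:R); last by rewrite expr2 ler_peMl ?ler1n.
    apply/ltW/(lt_le_trans (archi_boundP _)); first by rewrite divr_ge0 ?ltW.
    by rewrite ler_nat leqW // (leq_trans _ Kk) // leq_maxr.
  have [b1 b2] := bound k n (p n) (leq_trans (leq_maxl _ _) Kk) n1 n2 (p01 n)
    pn.
  by split; [apply: le_trans b1 | apply: le_trans b2]; rewrite lerD2l lerN2.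
(* Probabilities never exceed 1, so the lower bounds of [key] suffice. *)
split; apply/cvgrPdist_le => e /key; apply: filterS => n [b1 b2];
  by rewrite ger0_norm ?subr_ge0 ?pair_prob_le1 // lerBlDr addrC -lerBlDr.
Unshelve. all: by end_near.
Qed.
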